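(* Let $X$ be a real Banach space. If $T:X\rightrightarrows X^*$ is maximal monotone and has a unique maximal monotone extension $\tilde T:X^{**}\rightrightarrows X^*$ to the bidual, then at least one of the following conditions holds: 1) $T$ is of Gossez type (D); 2) $T$ is affine and non-enlargeable, that is, $T$ is an affine subspace of $X\times X^*$ and $$\varphi_T(x,x^* )=\begin{cases}\langle x,x^*\rangle,&(x,x^* )\in T,\\ \infty,&\text{otherwise},\end{cases}$$ and $\mathcal{F}_T=\{\varphi_T\}$.
   Context: $X$ is a real Banach space with dual $X^*$ and bidual $X^{**}$; $X$ is identified with its canonical image in $X^{**}$. $\overline{\mathbb{R}}=[-\infty,\infty]$. Duality products: $\langle x,x^*\rangle=x^*(x)$ on $X\times X^*$ and $\langle x^*,x^{**}\rangle=x^{**}(x^* )$ on $X^*\times X^{**}$; the order of the arguments is immaterial. A point-to-set operator $T:X\rightrightarrows X^*$ (resp. $T:X^{**}\rightrightarrows X^*$) is a subset of $X\times X^*$ (resp. $X^{**}\times X^*$). It is monotone if $\langle q-q',r-r'\rangle\ge0$ for all $(q,r),(q',r')\in T$, and maximal monotone if it is monotone and maximal under inclusion among monotone subsets of $X\times X^*$ (resp. of $X^{**}\times X^*$). A maximal monotone extension of $T:X\rightrightarrows X^*$ to the bidual is a maximal monotone operator $\tilde T:X^{**}\rightrightarrows X^*$ (maximal in $X^{**}\times X^*$) containing $T$. Gossez's monotone closure of a maximal monotone $T:X\rightrightarrows X^*$ is $\overline{T}^{\,g}=\{(x^{**},x^* )\in X^{**}\times X^*:\langle x^*-y^*,x^{**}-y\rangle\ge0\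 \forall (y,y^* )\in T\}$. $T$ is of Gossez type (D) if for every $(x^{**},x^* )\in\overline{T}^{\,g}$ there is a bounded net in $T$ converging to $(x^{**},x^* )$ in the $\sigma(X^{**},X^* )\times$strong topology of $X^{**}\times X^*$. The Fitzpatrick function of $T$ is $\varphi_T:X\times X^*\to\overline{\mathbb{R}}$, $\varphi_T(x,x^* )=\sup_{(y,y^* )\in T}\langle y,x^*\rangle+\langle y^*,x\rangle-\langle y,y^*\rangle$. The Fitzpatrick family $\mathcal{F}_T$ is the set of functions $h:X\times X^*\to\overline{\mathbb{R}}$ that are convex, lower semicontinuous (strong topology), satisfy $h(x,x^* )\ge\langle x,x^*\rangle$ for all $(x,x^* )\in X\times X^*$, and $h(x,x^* )=\langle x,x^*\rangle$ for all $(x,x^* )\in T$. *)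

(* Defs.v *)
From HB Require Import structures.
From mathcomp Require Import all_boot all_order all_algebra.
From mathcomp Require Import all_classical all_reals all_analysis.

Set Implicit Arguments.
Unset Strict Implicit.
Unset Printing Implicit Defensive.

Import Order.TTheory GRing.Theory Num.Theory.
Import numFieldNormedType.Exports.

Local Open Scope classical_set_scope.
Local Open Scope ring_scope.

(* The topological dual of a normed space, as a normed space. *)

Definition continuous_linear {R : realType} {X : normedModType R} :
    {pred X -> R^o} :=
  fun f => `[< linear f /\ continuous f >].

Section continuous_linear_submod.
Context {R : realType} {X : normedModType R}.

Lemma continuous_linear_submod_closed :
  submod_closed (@continuous_linear R X).
Proof.
split.
  apply/asboolP; split; first by move=> a x y /=; rewrite scaler0 addr0.
  exact: cst_continuous.
move=> a f g /asboolP[lf cf] /asboolP[lg cg]; apply/asboolP; split.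
  move=> b x y; have E z : (a *: f + g) z = a *: f z + g z by [].
  rewrite !E lf lg !scalerDr !scalerA mulrC -!addrA.
  by congr (_ + _); rewrite addrCA.
by move=> x; apply: cvgD; [apply: cvgZr; exact: cf|exact: cg].
Qed.

HB.instance Definition _ := GRing.isSubmodClosed.Build R (X -> R^o)
  (@continuous_linear R X) continuous_linear_submod_closed.

End continuous_linear_submod.

Record dual {R : realType} (X : normedModType R) := Dual {
  dual_fun :> X -> R^o ;
  dual_funP : dual_fun \in continuous_linear }.

Section dual_normed.
Context {R : realType} {X : normedModType R}.
Implicit Types (f g : dual X) (x y : X).

HB.instance Definition _ := [isSub for @dual_fun R X].
HB.instance Definition _ := [Choice of dual X by <:].
HB.instance Definition _ := [SubChoice_isSubLmodule of dual X by <:].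

Lemma dual_linear f : linear (f : X -> R^o).
Proof. by have /asboolP[] := dual_funP f. Qed.

Lemma dual_continuous f : continuous (f : X -> R^o).
Proof. by have /asboolP[] := dual_funP f. Qed.

HB.instance Definition _ f :=
  GRing.isLinear.Build R X R^o *:%R (dual_fun f) (dual_linear f).

Lemma dual_ext f g : (forall x, f x = g x) -> f = g.
Proof. by move=> fg; apply/val_inj/funext. Qed.

Lemma dualD f g x : (f + g) x = f x + g x.
Proof. by []. Qed.

Lemma dualZ (a : R) f x : (a *: f) x = a * f x.
Proof. by []. Qed.

Definition dual_norm f : R :=
  sup [set `|f x| | x in [set x : X | `|x| <= 1]].

Lemma dual_norm_has_sup f :
  has_sup [set `|f x| | x in [set x : X | `|x| <= 1]].
Proof.
split; first by exists `|f 0|, 0 => //=; rewrite normr0.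
have /(linear_bounded_continuous (dual_fun f)) := @dual_continuous f.
move=> /bounded_funP/(_ 1)[M fM].
by exists M => _ [x x1 <-]; exact: fM.
Qed.

Lemma dual_norm_ge0 f : 0 <= dual_norm f.
Proof.
apply: le_trans (normr_ge0 (f 0)) _.
apply: ub_le_sup; first by have [] := dual_norm_has_sup f.
by exists 0 => //=; rewrite normr0.
Qed.

Lemma dual_normP f x : `|f x| <= dual_norm f * `|x|.
Proof.
have [->|x0] := eqVneq x 0; first by rewrite linear0 !normr0 mulr0.
have nx : 0 < `|x| by rewrite normr_gt0.
rewrite -ler_pdivrMr// mulrC -[`|x|^-1]gtr0_norm ?invr_gt0//.
rewrite -normrM -[_ * f x]/(`|x|^-1 *: f x) -linearZ.
apply: ub_le_sup; first by have [] := dual_norm_has_sup f.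
by exists (`|x|^-1 *: x) => //=; rewrite normrZ gtr0_norm ?invr_gt0// mulVf ?gt_eqF.
Qed.

Lemma dual_norm_le f (M : R) : 0 <= M ->
  (forall x, `|f x| <= M * `|x|) -> dual_norm f <= M.
Proof.
move=> M0 fM; apply: ge_sup; first by have [] := dual_norm_has_sup f.
by move=> _ [x x1 <-]; apply: le_trans (fM x) _; exact: ler_piMr.
Qed.

Lemma dual_normD f g : dual_norm (f + g) <= dual_norm f + dual_norm g.
Proof.
apply: dual_norm_le => [|x]; first by rewrite addr_ge0// dual_norm_ge0.
by rewrite mulrDl (le_trans (ler_normD _ _))// lerD// dual_normP.
Qed.

Lemma dual_normZ (a : R) f : dual_norm (a *: f) = `|a| * dual_norm f.
Proof.
have le_aux b g : dual_norm (b *: g) <= `|b| * dual_norm g.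
  apply: dual_norm_le => [|x]; first by rewrite mulr_ge0// dual_norm_ge0.
  by rewrite dualZ normrM -mulrA ler_wpM2l// dual_normP.
apply/eqP; rewrite eq_le le_aux/=.
have [->|a0] := eqVneq a 0; first by rewrite normr0 mul0r dual_norm_ge0.
have := le_aux a^-1 (a *: f).
by rewrite scalerA mulVf// scale1r normfV ler_pdivlMl ?normr_gt0.
Qed.

Lemma dual_norm0_eq0 f : dual_norm f = 0 -> f = 0.
Proof.
move=> f0; apply: dual_ext => x; apply/normr0_eq0/le_anti.
by rewrite normr_ge0 andbT; have := dual_normP f x; rewrite f0 mul0r.
Qed.

HB.instance Definition _ :=
  Lmodule_isNormed.Build R (dual X) dual_normD dual_normZ dual_norm0_eq0.

End dual_normed.

(* The canonical embedding of X into its bidual. *)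

Section bidual.
Context {R : realType} {X : normedModType R}.

Lemma eval_continuous_linear (x : X) :
  (fun f : dual X => f x : R^o) \in continuous_linear.
Proof.
apply/asboolP; split => [a f g //|].
pose ev f : R^o := dual_fun f x.
have lev : linear ev by [].
pose evL : {linear dual X -> R^o} :=
  HB.pack ev (GRing.isLinear.Build _ _ _ _ _ lev).
apply/(linear_bounded_continuous evL)/bounded_funP => r.
exists (r * `|x|) => f fr; apply: le_trans (dual_normP f x) _.
exact: ler_wpM2r.
Qed.

Definition bidual_embed (x : X) : dual (dual X) :=
  Dual (eval_continuous_linear x).

End bidual.

Section operators.
Context {R : realType}.

Section monotone.
Variables (Q S : zmodType) (br : Q -> S -> R).
Implicit Types A B : set (Q * S).

Definition monotone_operator A :=
  forall p p', A p -> A p' -> 0 <= br (p.1 - p'.1) (p.2 - p'.2).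

Definition maximal_monotone A :=
  monotone_operator A /\
  forall B, monotone_operator B -> A `<=` B -> B = A.

End monotone.

Definition affine_subspace (V : lmodType R) (A : set V) :=
  exists (a : V) (L : set V),
    [/\ L 0, forall (c : R) u v, L u -> L v -> L (c *: u + v)
      & A = [set a + u | u in L]].

(* Requiring the inequality only where h is not +oo amounts to the convention
   +oo - oo = +oo, whereas +oo - oo = -oo in \bar R. *)
Definition convex_efun (V : lmodType R) (h : V -> \bar R) :=
  forall (u v : V) (t : R), 0 < t < 1 ->
    (h u < +oo)%E -> (h v < +oo)%E ->
    (h (t *: u + (1 - t) *: v)%R <= t%:E * h u + (1 - t)%:E * h v)%E.

End operators.

Record directed (I : Type) (le : I -> I -> Prop) : Prop := Directed {
  directed_inhabited : inhabited I ;
  directed_refl : forall i, le i i ;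
  directed_trans : forall i j k, le i j -> le j k -> le i k ;
  directed_ub : forall i j, exists2 k, le i k & le j k }.

Definition tails (I : Type) (le : I -> I -> Prop) : set_system I :=
  filter_from [set: I] (fun i => [set j | le i j]).

(* The bidual with the topology sigma(X^**, X^* ). *)
Definition weak_star_bidual {R : realType} (X : normedModType R) :=
  initial_topology
    (fun u : dual (dual X) => (dual_fun u : {ptws dual X -> R^o})).

HB.instance Definition _ {R : realType} (X : normedModType R) :=
  Topological.on (weak_star_bidual X).

Section bidual_operators.
Context {R : realType} {X : normedModType R}.
Implicit Types (T : set (X * dual X)) (S : set (dual (dual X) * dual X)).

Definition pairing (x : X) (xs : dual X) : R := xs x.

Definition bipairing (xss : dual (dual X)) (xs : dual X) : R := xss xs.

Definition bidual_extension T S :=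
  maximal_monotone bipairing S /\
  [set (bidual_embed p.1, p.2) | p in T] `<=` S.

Definition gossez_closure T : set (dual (dual X) * dual X) :=
  [set q | forall p, T p -> 0 <= bipairing (q.1 - bidual_embed p.1) (q.2 - p.2)].

Definition gossez_type_D T :=
  forall q, gossez_closure T q ->
    exists (I : Type) (le : I -> I -> Prop) (a : I -> X * dual X),
      [/\ directed le, forall i, T (a i), bounded_set (range a) &
          (fun i => (bidual_embed (a i).1, (a i).2)
             : weak_star_bidual X * dual X) @ tails le
            --> (q : weak_star_bidual X * dual X)].

Definition fitzpatrick T (q : X * dual X) : \bar R :=
  ereal_sup [set (pairing p.1 q.2 + pairing q.1 p.2 - pairing p.1 p.2)%:E
            | p in T].

Definition fitzpatrick_family T : set (X * dual X -> \bar R) :=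
  [set h : X * dual X -> \bar R |
    [/\ convex_efun h,
        lower_semicontinuous h,
        forall p, ((pairing p.1 p.2)%:E <= h p)%E
      & forall p, T p -> h p = (pairing p.1 p.2)%:E]].

Definition affine_nonenlargeable T :=
  [/\ affine_subspace T,
      fitzpatrick T =
        (fun p => if p \in T then (pairing p.1 p.2)%:E else +oo%E)
    & fitzpatrick_family T = [set fitzpatrick T]].

End bidual_operators.

(* Main.v *)
Require Import Defs.
From HB Require Import structures.
From mathcomp Require Import all_boot all_order all_algebra.
From mathcomp Require Import all_classical all_reals all_analysis.
From mathcomp Require Import ring lra.

(* Write p for the duality product, phi for the Fitzpatrick function of T
   extended to X^** x X^*. Uniqueness of the extension makes the Gossez closure
   {phi <= p} monotone.

   If phi < p at some point q0, short segments from q0 to dom phi stay in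
   {phi <= p}, so dom phi itself is monotone; hence dom phi_T = T, which makes T
   convex. A convex maximal monotone set is affine, and every member of the
   Fitzpatrick family dominates phi_T, hence equals it.

   If phi >= p everywhere, then T is of type (D). Indeed phi_T has the
   Brondsted-Rockafellar property: by Fenchel duality phi_T plus half the
   squared norms, recentred at a point z with phi_T(z) <= p(z) + s^2, has
   infimum at most 0, which yields w within 3 s of z with
   phi_T(w) <= p(w) + (s/2)^2; iterating converges to a point of T. And for q in the Gossez closure,
   comparing convex functions above p that touch p at q gives first
   phi(z) >= <q,z> - p(q), then phi_T^*(u) >= <q,u> - p(q), so that by duality q
   is a limit of bounded points z of X x X^*, weak* in the first component and
   strong in the second, with phi_T(z) - p(z) -> 0. *)

Set Implicit Arguments.
Unset Strict Implicit.
Unset Printing Implicit Defensive.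

Import Order.TTheory GRing.Theory Num.Theory.
Import numFieldNormedType.Exports.

Local Open Scope classical_set_scope.
Local Open Scope ring_scope.

(** * Hahn-Banach and a sandwich theorem *)

Section hahn_banach.
Context {R : realType} {V : lmodType R}.
Implicit Types (p q : V -> R) (x y z w : V).

(** Homogeneity is an inequality for positive factors only, a form that infima inherit directly;
    [sublinearZ] recovers the equality. *)
Definition sublinear p :=
  (forall x y, p (x + y) <= p x + p y) /\
  (forall t x, 0 < t -> p (t *: x) <= t * p x).

Lemma sublinearZ p t x : sublinear p -> 0 < t -> p (t *: x) = t * p x.
Proof.
move=> [_ pZ] t0; apply/eqP; rewrite eq_le pZ//=.
have := pZ t^-1 (t *: x); rewrite invr_gt0 => /(_ t0).
by rewrite scalerA mulVf ?gt_eqF// scale1r ler_pdivlMl.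
Qed.

Lemma sublinear0 p : sublinear p -> p 0 = 0.
Proof.
by move=> sp; have := @sublinearZ p 2 0 sp ltac:(lra); rewrite scaler0; lra.
Qed.

Lemma sublinearN p x : sublinear p -> - p (- x) <= p x.
Proof.
by move=> sp; have := sp.1 x (- x); rewrite subrr sublinear0//; lra.
Qed.

(** The index may change from one side to the other, which covers infima of chains as well as infima
    over shifts along a direction. *)
Lemma inf_image_sublinear (I : Type) (A : set I) (f : I -> V -> R) :
  A !=set0 ->
  (forall x, has_lbound [set f i x | i in A]) ->
  (forall i j x y, A i -> A j ->
     exists2 k, A k & f k (x + y) <= f i x + f j y) ->
  (forall i t x, A i -> 0 < t -> exists2 k, A k & f k (t *: x) <= t * f i x) ->
  sublinear (fun x => inf [set f i x | i in A]).
Proof.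
move=> [i0 Ai0] lbf fD fZ.
have ne x : [set f i x | i in A] !=set0 by exists (f i0 x), i0.
have le_inf i x : A i -> inf [set f i x | i in A] <= f i x.
  by move=> Ai; apply: ge_inf; [exact: lbf|exists i].
split=> [x y|t x t0].
  rewrite -lerBlDr; apply: lb_le_inf => // _ [i Ai <-].
  rewrite lerBlDr -lerBlDl; apply: lb_le_inf => // _ [j Aj <-].
  rewrite lerBlDl.
  by have [k Ak] := fD _ _ x y Ai Aj; apply: le_trans; exact: le_inf.
rewrite -ler_pdivrMl//; apply: lb_le_inf => // _ [i Ai <-].
rewrite ler_pdivrMl//.
by have [k Ak] := fZ _ _ x Ai t0; apply: le_trans; exact: le_inf.
Qed.

(** Zorn's lemma for the reversed pointwise order. A chain below [p] is bounded below by [- p (- x)]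
    at [x], so its infimum is again sublinear. *)
Lemma minimal_sublinear p : sublinear p ->
  exists q, [/\ sublinear q, forall x, q x <= p x &
    forall q', sublinear q' -> (forall x, q' x <= q x) -> q' = q].
Proof.
move=> sp.
pose D := {q | sublinear q /\ forall x, q x <= p x}.
pose le (a b : D) := `[< forall x, sval b x <= sval a x >].
have [a|a b c /asboolP ab /asboolP bc|A Atot|] :=
    @ZL_preorder D (exist _ p (conj sp (fun x => lexx _))) le.
- exact/asboolP.
- by apply/asboolP => x; exact: le_trans (bc x) (ab x).
- have [[a0 Aa0]|A0] := pselect (A !=set0); last first.
    exists (exist _ p (conj sp (fun x => lexx _))) => a Aa.
    by exfalso; apply: A0; exists a.
  have lbA x : has_lbound [set sval a x | a in A].
    exists (- p (- x)) => _ [a Aa <-].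
    apply: le_trans (sublinearN x (svalP a).1).
    by rewrite lerN2; exact: (svalP a).2.
  have sq : sublinear (fun x => inf [set sval a x | a in A]).
    apply: (@inf_image_sublinear _ A (fun a => sval a)) => //.
    + by exists a0.
    + move=> a b x y Aa Ab.
      have [/asboolP ab|/asboolP ba] := Atot a b Aa Ab.
        exists b => //; apply: le_trans ((svalP b).1.1 x y) _.
        by rewrite lerD2r.
      exists a => //; apply: le_trans ((svalP a).1.1 x y) _.
      by rewrite lerD2l.
    + by move=> a t x Aa t0; exists a => //; exact: (svalP a).1.2.
  have qp x : inf [set sval a x | a in A] <= p x.
    apply: le_trans ((svalP a0).2 x).
    by apply: ge_inf; [exact: lbA|exists a0].
  exists (exist (fun q => sublinear q /\ forall x, q x <= p x) _ (conj sq qp)).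
  move=> a Aa; apply/asboolP => x /=.
  by apply: ge_inf; [exact: lbA|exists a].
move=> [q [sq qp]] qmin; exists q; split=> // q' sq' q'q.
apply/funext => x; apply/eqP; rewrite eq_le q'q/=.
have q'p y : q' y <= p y by exact: le_trans (q'q y) (qp y).
have /asboolP := qmin (exist _ q' (conj sq' q'p)) ltac:(exact/asboolP).
exact.
Qed.

(** Fix [x0]. The infimum over [t >= 0] of [q (y + t *: x0) - t * q x0] is sublinear and below [q],
    hence equal to [q]; the term [t = 1] gives superadditivity. *)
Lemma minimal_sublinear_linear q : sublinear q ->
  (forall q', sublinear q' -> (forall x, q' x <= q x) -> q' = q) ->
  linear (q : V -> R^o).
Proof.
move=> sq qmin.
have q0 := sublinear0 sq.
have qD x x0 : q (x + x0) = q x + q x0.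
  apply/eqP; rewrite eq_le sq.1/=.
  pose f (t : R) y := q (y + t *: x0) - t * q x0.
  have qtx t : 0 <= t -> q (t *: x0) = t * q x0.
    rewrite le_eqVlt => /predU1P[<-|t0]; last exact: sublinearZ.
    by rewrite scale0r mul0r q0.
  have lbf y : has_lbound [set f t y | t in [set t | 0 <= t]].
    exists (- q (- y)) => _ [t /= t0 <-]; rewrite /f.
    have := sq.1 (- y) (y + t *: x0); rewrite addKr qtx//; lra.
  have sf : sublinear (fun y => inf [set f t y | t in [set t | 0 <= t]]).
    apply: inf_image_sublinear => //.
    - by exists 0 => /=.
    - move=> s t y z /= s0 t0; exists (s + t); first exact: addr_ge0.
      rewrite /f scalerDl addrACA.
      have := sq.1 (y + s *: x0) (z + t *: x0); lra.
    - move=> s t y /= s0 t0; exists (t * s); first by rewrite mulr_ge0// ltW.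
      by rewrite /f -scalerA -scalerDr sublinearZ// mulrBr mulrA.
  have fq : (fun y => inf [set f t y | t in [set t | 0 <= t]]) = q.
    apply: qmin => // y; apply: ge_inf; first exact: lbf.
    by exists 0 => //=; rewrite /f scale0r mul0r addr0 subr0.
  rewrite -[X in X + _](congr1 (fun h => h x) fq) -lerBrDr.
  apply: ge_inf; first exact: lbf.
  by exists 1 => //=; rewrite /f scale1r mul1r.
have qN x : q (- x) = - q x by have := qD x (- x); rewrite subrr q0; lra.
move=> t x y; rewrite qD; congr (_ + _).
have [t0|t0|->] := ltgtP t 0; last by rewrite scale0r q0 scale0r.
  by rewrite -[t]opprK scaleNr qN sublinearZ ?oppr_gt0// -mulNr.
exact: sublinearZ.
Qed.

Lemma hahn_banach p : sublinear p ->
  exists u : {linear V -> R^o}, forall x, u x <= p x.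
Proof.
move=> /minimal_sublinear[q [sq qp qmin]].
have lq := minimal_sublinear_linear sq qmin.
pose u : {linear V -> R^o} :=
  HB.pack (q : V -> R^o) (GRing.isLinear.Build _ _ _ _ _ lq).
by exists u.
Qed.

(** [E x r] stands for an extended-real convex function being at most [r] at [x]; points outside its
    domain are related to no real. *)
Definition convex_rel (E : V -> R -> Prop) := forall x y r s t, 0 < t < 1 ->
  E x r -> E y s -> E (t *: x + (1 - t) *: y) (t * r + (1 - t) * s).

Definition convex_real (g : V -> R) := forall x y t, 0 < t < 1 ->
  g (t *: x + (1 - t) *: y) <= t * g x + (1 - t) * g y.

(** With [c] the supremum of [u x - r] over [E x r], the affine function [u - c] lies between [- g]
    and [E]. Hahn-Banach yields [u] below the infimum [S v] of the costs [l * (r + g y)] over all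
    representations [v = l *: (x - y)]. *)
Lemma sandwich (E : V -> R -> Prop) (g : V -> R) :
  convex_rel E -> convex_real g -> (exists x r, E x r) ->
  (forall x r, E x r -> 0 <= r + g x) ->
  exists u : {linear V -> R^o}, forall x r y, E x r -> u x - u y <= r + g y.
Proof.
move=> cE cg [x0 [r0 E0]] Eg.
pose A v := [set i : R * (V * R * V) |
  [/\ 0 < i.1, E i.2.1.1 i.2.1.2 & v = i.1 *: (i.2.1.1 - i.2.2)]].
pose f (i : R * (V * R * V)) : R := i.1 * (i.2.1.2 + g i.2.2).
have AD v w i j : A v i -> A w j -> exists2 k, A (v + w) k & f k <= f i + f j.
  case: i j => [l [[x r] y]] [m [[x' r'] y']].
  move=> [/= l0 Ex ->] [/= m0 Ex' ->].
  have lm0 : 0 < l + m by exact: addr_gt0.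
  (* With this weight, convex combinations of the two representations, scaled by [l + m], represent
     [v + w]. *)
  pose t := l / (l + m).
  have t01 : 0 < t < 1.
    by rewrite /t divr_gt0//= ltr_pdivrMr// mul1r ltrDl.
  have tl : (l + m) * t = l by rewrite /t mulrC divfK// gt_eqF.
  have tm : (l + m) * (1 - t) = m by rewrite mulrBr tl; ring.
  clearbody t.
  exists (l + m, (t *: x + (1 - t) *: x', t * r + (1 - t) * r',
                  t *: y + (1 - t) *: y')).
    split=> //=; first exact: cE.
    transitivity ((l + m) *: (t *: (x - y) + (1 - t) *: (x' - y'))).
      by rewrite [RHS]scalerDr !scalerA tl tm.
    by rewrite opprD addrACA -!scalerBr.
  rewrite /f/=.
  have tlm a b : (l + m) * (t * a + (1 - t) * b) = l * a + m * b.
    by rewrite mulrDr !mulrA tl tm.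
  rewrite [leLHS]mulrDr tlm.
  have := cg y y' t t01; rewrite -(ler_pM2l lm0) tlm; lra.
have A0 k : A 0 k -> 0 <= f k.
  case: k => [l [[x r] y]] [/= l0 Ex /esym/eqP].
  rewrite scaler_eq0 gt_eqF//= subr_eq0 => /eqP xy.
  by rewrite /f/= -xy; apply: mulr_ge0; [exact: ltW|exact: Eg].
(* As [g] is finite everywhere, [y] is free: [v = x0 - (x0 - v)]. *)
have Ane v : A v !=set0.
  exists (1, (x0, r0, x0 - v)); split=> //=.
  by rewrite scale1r opprB addrC subrK.
pose S v := inf [set f i | i in A v].
have lbS v : has_lbound [set f i | i in A v].
  (* Adding a representation of [- v] to one of [v] represents 0, at nonnegative cost. *)
  have [j Aj] := Ane (- v); exists (- f j) => _ [i Ai <-].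
  have [k] := AD _ _ _ _ Ai Aj; rewrite subrr => /A0; lra.
have neS v : [set f i | i in A v] !=set0.
  by have [i Ai] := Ane v; exists (f i), i.
have leS v i : A v i -> S v <= f i.
  by move=> Ai; apply: ge_inf; [exact: lbS|exists i].
have sS : sublinear S.
  split=> [v w|t v t0].
    rewrite -lerBlDr; apply: lb_le_inf => // _ [i Ai <-].
    rewrite lerBlDr -lerBlDl; apply: lb_le_inf => // _ [j Aj <-].
    by rewrite lerBlDl; have [k /leS] := AD _ _ _ _ Ai Aj; exact: le_trans.
  rewrite -ler_pdivrMl//; apply: lb_le_inf => // _ [i Ai <-].
  rewrite ler_pdivrMl//.
  case: i Ai => [l [[x r] y]] [/= l0 Ex ->].
  rewrite /f/= mulrA; apply: (@leS _ (t * l, (x, r, y))).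
  by split=> //=; rewrite ?mulr_gt0// scalerA.
have [u uS] := hahn_banach sS; exists u => x r y Ex.
rewrite -[_ - _]/(u x - u y : R^o) -linearB; apply: le_trans (uS _) _.
rewrite -[r + g y]mul1r; apply: (@leS _ (1, (x, r, y))).
by split=> //=; rewrite scale1r.
Qed.

End hahn_banach.

(** * Convex real-valued functions *)

Section convex_functions.
Context {R : realType}.

Lemma convex_comb_subr (V : lmodType R) (x y z : V) (t : R) :
  t *: x + (1 - t) *: y - z = t *: (x - z) + (1 - t) *: (y - z).
Proof.
rewrite !scalerBr addrACA -opprD -scalerDl.
by rewrite (_ : t + (1 - t) = 1) ?scale1r//; ring.
Qed.

Lemma convex_real_norm (V W : normedModType R) (f : V -> W) :
  (forall x y t, f (t *: x + (1 - t) *: y) = t *: f x + (1 - t) *: f y) ->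
  convex_real (fun x => `|f x|).
Proof.
move=> fE x y t /andP[t0 t1]; rewrite fE.
by rewrite (le_trans (ler_normD _ _))// !normrZ !ger0_norm//; lra.
Qed.

Lemma convex_real_sqr (V : lmodType R) (g : V -> R) :
  (forall x, 0 <= g x) -> convex_real g -> convex_real (fun x => g x ^+ 2).
Proof.
move=> g0 cg x y t t01; have := cg x y t t01; have [t0 t1] := andP t01.
move: (g0 x) (g0 y) (g0 (t *: x + (1 - t) *: y)).
move: (g (t *: x + (1 - t) *: y)) (g x) (g y) => c a b a0 b0 c0 cab.
have : c ^+ 2 <= (t * a + (1 - t) * b) ^+ 2.
  rewrite ler_sqr ?nnegrE//.
  by apply: addr_ge0; apply: mulr_ge0 => //; lra.
move=> /le_trans; apply; rewrite -subr_ge0.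
have -> : t * a ^+ 2 + (1 - t) * b ^+ 2 - (t * a + (1 - t) * b) ^+ 2 =
  t * (1 - t) * (a - b) ^+ 2 by ring.
by rewrite mulr_ge0 ?sqr_ge0// mulr_ge0//; lra.
Qed.

Lemma convex_realD (V : lmodType R) (f g : V -> R) :
  convex_real f -> convex_real g -> convex_real (fun x => f x + g x).
Proof.
by move=> cf cg x y t t01; have := cf x y t t01; have := cg x y t t01; lra.
Qed.

Lemma convex_realB (V : lmodType R) (f : V -> R) (c : R) :
  convex_real f -> convex_real (fun x => f x - c).
Proof. by move=> cf x y t t01; have := cf x y t t01; lra. Qed.

Lemma convex_realZ (V : lmodType R) (f : V -> R) (c : R) : 0 <= c ->
  convex_real f -> convex_real (fun x => c * f x).
Proof.
move=> c0 cf x y t t01; rewrite !(mulrCA _ c) -mulrDr.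
by apply: ler_wpM2l; [exact: c0|exact: cf].
Qed.

Lemma convex_real_sum (V : lmodType R) (I : Type) (r : seq I)
    (f : I -> V -> R) :
  (forall i, convex_real (f i)) -> convex_real (fun x => \sum_(i <- r) f i x).
Proof.
move=> cf x y t t01; rewrite !mulr_sumr -big_split/=.
by apply: ler_sum => i _; exact: cf.
Qed.

Lemma convex_real_max0 (V : lmodType R) (f : V -> R) :
  convex_real f -> convex_real (fun x => Num.max 0 (f x)).
Proof.
move=> cf x y t t01; have := cf x y t t01; have [t0 t1] := andP t01.
move: (f (t *: x + (1 - t) *: y)) (f x) (f y) => c a b cab.
have m0 d : 0 <= Num.max 0 d :> R by rewrite le_max lexx.
have ma d : d <= Num.max 0 d :> R by rewrite le_max lexx orbT.
have ha : t * a <= t * Num.max 0 a by apply: ler_wpM2l => //; exact: ltW.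
have hb : (1 - t) * b <= (1 - t) * Num.max 0 b by apply: ler_wpM2l => //; lra.
have t1' : 0 <= 1 - t by lra.
rewrite ge_max; apply/andP; split; last lra.
by apply: addr_ge0; apply: mulr_ge0 => //; exact: ltW.
Qed.

End convex_functions.

(** * Duals and biduals *)

Section dual_construction.
Context {R : realType}.

(** A one-sided bound suffices because the unit ball is symmetric. *)
Lemma dual_of_bounded (V : normedModType R) (u : {linear V -> R^o}) (M : R) :
  (forall x, `|x| <= 1 -> u x <= M) -> exists f : dual V, forall x, f x = u x.
Proof.
move=> uM; suff uP : (u : V -> R^o) \in continuous_linear by exists (Dual uP).
apply/asboolP; split; first exact: linearP.
apply/linear_bounded_continuous/bounded_funP => r.
have uabs x : `|x| <= 1 -> `|u x : R| <= M.
  move=> x1; rewrite ler_norml uM// andbT lerNl.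
  by have := uM (- x); rewrite normrN linearN; exact.
pose k := `|r| + 1; have k0 : 0 < k by rewrite ltr_wpDl.
exists (k * M) => x xr.
have -> : x = k *: (k^-1 *: x) by rewrite scalerA divff ?scale1r// gt_eqF.
rewrite linearZ normrM gtr0_norm// ler_pM2l//; apply: uabs.
rewrite normrZ normfV gtr0_norm// ler_pdivrMl// mulr1.
by rewrite (le_trans xr)// /k (le_trans (ler_norm r))// lerDl.
Qed.

Lemma dual_approx_norm (V : normedModType R) (f : dual V) (M e : R) :
  0 <= M -> 0 < e -> exists2 x, `|x| <= M & M * `|f| - e <= f x.
Proof.
rewrite le_eqVlt => /predU1P[<- e0|M0 e0].
  by exists 0; rewrite ?normr0// linear0 mul0r; lra.
have e'0 : 0 < e / M by exact: divr_gt0.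
have [_ [x /= x1 <-] fx] := sup_adherent e'0 (dual_norm_has_sup f).
wlog fx0 : x x1 fx / 0 <= f x => [H|].
  have [|/ltW] := leP 0 (f x); first exact: H.
  by move=> fx0; apply: (H (- x)); rewrite ?normrN// linearN ?normrN ?oppr_ge0.
exists (M *: x); first by rewrite normrZ gtr0_norm// ler_piMr// ltW.
rewrite linearZ/=.
move: fx; rewrite -/(dual_norm f) -[dual_norm f]/`|f| ger0_norm//.
by rewrite -(ltr_pM2l M0) mulrBr (mulrC _ (e / _)) divfK ?gt_eqF// => /ltW.
Qed.

Lemma dual_sumZ (V : normedModType R) (I : Type) (r : seq I) (c : I -> R)
    (f : I -> dual V) (x : V) :
  (\sum_(i <- r) c i *: f i) x = \sum_(i <- r) c i * f i x :> R.
Proof. by elim/big_rec2: _ => // i y1 y2 _ <-. Qed.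

(** Otherwise the image of the ball in [R^n] can be separated from the values of [xss]. The
    separating functional is a combination [f] of [L] with [f x <= xss f - e] on the ball, whereas
    [f] nearly attains [|xss| * |f|] there. *)
Lemma goldstine (V : normedModType R) (xss : dual (dual V)) (L : seq (dual V))
    (e : R) : 0 < e ->
  exists2 x, `|x| <= `|xss| & \sum_(f <- L) `|f x - xss f : R| < e.
Proof.
move=> e0; apply: contrapT => nx.
have {}nx x : `|x| <= `|xss| -> e <= \sum_(f <- L) `|f x - xss f : R|.
  by move=> xM; rewrite leNgt; apply/negP => lte; apply: nx; exists x.
pose n := size L; pose f_ (i : 'I_n) := nth 0 L i.
pose row (x : V) : 'rV[R]_n := \row_i (f_ i x : R).
pose a : 'rV[R]_n := \row_i (xss (f_ i) : R).
(* The epigraph of the indicator function of the image of the ball. *)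
pose E (z : 'rV[R]_n) (r : R) := 
  0 <= r /\ exists2 x, `|x| <= `|xss| & z = row x.
pose g (w : 'rV[R]_n) := \sum_i `|w 0 i - a 0 i| - e.
have cE : convex_rel E.
  move=> _ _ r s t /andP[t0 t1] [r0 [x xM ->]] [s0 [y yM ->]]; split.
    by rewrite addr_ge0// mulr_ge0//; lra.
  exists (t *: x + (1 - t) *: y).
    apply: le_trans (ler_normD _ _) _; rewrite !normrZ !ger0_norm; [|lra..].
    have -> : `|xss| = t * `|xss| + (1 - t) * `|xss| by ring.
    by rewrite lerD// ler_wpM2l//; lra.
  by apply/rowP => i; rewrite !mxE linearD !linearZ.
have cg : convex_real g.
  apply: convex_realB; apply: convex_real_sum => i.
  apply: (@convex_real_norm _ _ R^o (fun w : 'rV_n => w 0 i - a 0 i)) => x y t.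
  by rewrite !mxE; exact: convex_comb_subr.
have [||u uE] := sandwich cE cg.
- by exists (row 0), 0; split=> //; exists 0; rewrite ?normr0.
- move=> _ r [r0 [x xM ->]]; rewrite addr_ge0// subr_ge0.
  rewrite (le_trans (nx x xM))// (big_nth 0) big_mkord.
  by apply: ler_sum => i _; rewrite !mxE.
pose f := \sum_i (u (delta_mx 0 i) : R) *: f_ i.
have uvE (v : 'rV[R]_n) : u v = \sum_i (u (delta_mx 0 i) : R) * v 0 i :> R.
  rewrite [in LHS](row_sum_delta v) linear_sum; apply: eq_bigr => i _.
  by rewrite linearZ mulrC.
have urow x : u (row x) = f x :> R.
  by rewrite uvE dual_sumZ; apply: eq_bigr => i _; rewrite mxE.
have ua : u a = xss f :> R.
  rewrite uvE linear_sum; apply: eq_bigr => i _; rewrite mxE.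
  by rewrite linearZ.
have e20 : 0 < e / 2 by lra.
have [x xM fx] := dual_approx_norm f (normr_ge0 xss) e20.
have := uE (row x) 0 a (conj (lexx _) (ex_intro2 _ _ x xM erefl)).
rewrite -[u _ - u _]/((u (row x) : R) - (u a : R)) urow ua /g.
rewrite big1 => [|i _]; last by rewrite subrr normr0.
have := dual_normP xss f; rewrite -[dual_norm xss]/`|xss| ler_norml => /andP[_].
move: fx; set p : R := f x; set q : R := xss f; lra.
Qed.

End dual_construction.

(** * The sandwich theorem on the product of a space and its dual *)

Section bracket.
Context {R : realType} {X : normedModType R}.

(** Functionals on the product of [X] and its dual, with their two components swapped so that they
    live in the same space as the extended operators. *)
Definition bracket (q : dual (dual X) * dual X) (z : X * dual X) : R :=
  bipairing q.1 z.2 + pairing z.1 q.2.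

(** The sandwich functional is continuous: one point of [E] and the bound on [g] bound it on the
    unit ball. Its restrictions to the two factors form [q]. *)
Lemma sandwich_bidual (E : X * dual X -> R -> Prop) (g : X * dual X -> R)
    (M : R) :
  convex_rel E -> convex_real g -> (exists z r, E z r) ->
  (forall w, `|w.1| <= 1 -> `|w.2| <= 1 -> g w <= M) ->
  (forall z r, E z r -> 0 <= r + g z) ->
  exists q, forall z r w, E z r -> bracket q z - bracket q w <= r + g w.
Proof.
move=> cE cg [z0 [r0 E0]] gM Eg.
have [u uE] := sandwich cE cg (ex_intro _ z0 (ex_intro _ r0 E0)) Eg.
have ub w : `|w.1| <= 1 -> `|w.2| <= 1 -> u w <= r0 + M - u z0.
  move=> w1 w2; have := uE z0 r0 (- w) E0; have := gM (- w).
  rewrite !normrN => /(_ w1 w2); rewrite linearN; set a := u _; set b := u _.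
  by move: a b => /= a b; lra.
have l1 : linear (fun x : X => u (x, 0)).
  move=> c x y; rewrite -linearP; congr (u _).
  by congr pair; rewrite /= scaler0 addr0.
have l2 : linear (fun f : dual X => u (0, f)).
  move=> c x y; rewrite -linearP; congr (u _).
  by congr pair; rewrite /= scaler0 addr0.
pose u1 : {linear X -> R^o} := HB.pack (fun x : X => u (x, 0))
  (GRing.isLinear.Build _ _ _ _ _ l1).
pose u2 : {linear dual X -> R^o} := HB.pack (fun f : dual X => u (0, f))
  (GRing.isLinear.Build _ _ _ _ _ l2).
have [|xs xsE] := @dual_of_bounded _ _ u1 (r0 + M - u z0).
  by move=> x x1; apply: ub; rewrite /= ?normr0.
have [|xss xssE] := @dual_of_bounded _ _ u2 (r0 + M - u z0).
  by move=> x x1; apply: ub; rewrite /= ?normr0.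
exists (xss, xs) => z r w /uE - /(_ w).
have bE v : bracket (xss, xs) v = u v.
  rewrite /bracket /bipairing /pairing/= xsE xssE /= -[_ + _]/(_ + _ : R^o).
  rewrite -linearD; congr (u _); case: v => x f.
  by congr pair; rewrite /= ?addr0 ?add0r.
by rewrite !bE.
Qed.

End bracket.

(** * Monotone sets for a bilinear pairing *)

Section pairings.
Context {R : realType} {Q S : lmodType R}.
Implicit Types (br : Q -> S -> R) (A B : set (Q * S)) (p q z : Q * S).

Definition bilinear_pairing br :=
  (forall c x y s, br (c *: x + y) s = c * br x s + br y s) /\
  (forall c x s t, br x (c *: s + t) = c * br x s + br x t).

(** The polar form of the quadratic form [br z.1 z.2]. *)
Definition cross br p q : R := br p.1 q.2 + br q.1 p.2.

Section bilinear.
Context br (brP : bilinear_pairing br).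

Lemma br0l s : br 0 s = 0.
Proof. by have := brP.1 1 0 0 s; rewrite scaler0 addr0; lra. Qed.

Lemma br0r x : br x 0 = 0.
Proof. by have := brP.2 1 x 0 0; rewrite scaler0 addr0; lra. Qed.

Lemma brZl c x s : br (c *: x) s = c * br x s.
Proof. by rewrite -[c *: x]addr0 brP.1 br0l addr0. Qed.

Lemma brZr c x s : br x (c *: s) = c * br x s.
Proof. by rewrite -[c *: s]addr0 brP.2 br0r addr0. Qed.

Lemma brDl x y s : br (x + y) s = br x s + br y s.
Proof. by rewrite -{1}[x]scale1r brP.1 mul1r. Qed.

Lemma brDr x s t : br x (s + t) = br x s + br x t.
Proof. by rewrite -{1}[s]scale1r brP.2 mul1r. Qed.

Lemma brNl x s : br (- x) s = - br x s.
Proof. by rewrite -scaleN1r brZl mulN1r. Qed.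

Lemma brNr x s : br x (- s) = - br x s.
Proof. by rewrite -scaleN1r brZr mulN1r. Qed.

Definition brE := (brDl, brDr, brNl, brNr, brZl, brZr, br0l, br0r).

Lemma br_sub p q :
  br (p.1 - q.1) (p.2 - q.2) = br p.1 p.2 + br q.1 q.2 - cross br q p.
Proof. by rewrite /cross !brE; ring. Qed.

Lemma br_comb t p q : br (t *: p + (1 - t) *: q).1 (t *: p + (1 - t) *: q).2 =
  t ^+ 2 * br p.1 p.2 + t * (1 - t) * cross br p q + (1 - t) ^+ 2 * br q.1 q.2.
Proof. by rewrite /cross /= !brE; ring. Qed.

Lemma cross_comb t a p q : cross br a (t *: p + (1 - t) *: q) =
  t * cross br a p + (1 - t) * cross br a q.
Proof. by rewrite /cross /= !brE; ring. Qed.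

(* [fitz br A q r] says that the Fitzpatrick function of [A] is at most [r]
   at [q]; working with such upper bounds avoids infinite values. *)
Definition fitz A q r := forall p, A p -> cross br p q - br p.1 p.2 <= r.

Lemma fitz_convex A : convex_rel (fitz A).
Proof.
move=> p q r s t /andP[t0 t1] Ar As a Aa.
have {}Ar := Ar a Aa; have {}As := As a Aa.
have -> : cross br a (t *: p + (1 - t) *: q) - br a.1 a.2 =
    t * (cross br a p - br a.1 a.2) + (1 - t) * (cross br a q - br a.1 a.2).
  by rewrite cross_comb; ring.
by rewrite lerD// ler_wpM2l//; lra.
Qed.

Lemma fitz_related A q :
  fitz A q (br q.1 q.2) <-> forall p, A p -> 0 <= br (q.1 - p.1) (q.2 - p.2).
Proof. by split=> Aq p /Aq; rewrite br_sub; lra. Qed.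

Lemma fitz_monotone A p :
  monotone_operator br A -> A p -> fitz A p (br p.1 p.2).
Proof. by move=> mA Ap; apply/fitz_related => q; exact: mA. Qed.

Lemma maximal_related A q : maximal_monotone br A ->
  (forall p, A p -> 0 <= br (q.1 - p.1) (q.2 - p.2)) -> A q.
Proof.
move=> [mA Amax] Aq.
suff <- : A `|` [set q] = A by right.
apply: Amax; last exact: subsetUl.
move=> p p' [Ap|->] [Ap'|->]; first exact: mA.
- by have := Aq p Ap; rewrite !br_sub /cross; lra.
- exact: Aq.
- by rewrite !subrr br0l.
Qed.

Lemma maximal_nonempty A : maximal_monotone br A -> A !=set0.
Proof.
move=> Amax; apply: contrapT => A0; apply: (A0); exists 0.
by apply: maximal_related => // p Ap; exfalso; apply: A0; exists p.
Qed.

(** If [r] were smaller, [q] would be related to [A], hence in [A]; testing the bound at [q] itself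
    gives a contradiction. *)
Lemma fitz_ge A q r : maximal_monotone br A -> fitz A q r -> br q.1 q.2 <= r.
Proof.
move=> Amax Aq; rewrite leNgt; apply/negP => rq.
have /Aq : A q.
  apply: (maximal_related Amax); apply/fitz_related => p /Aq.
  by move/le_trans; apply; exact: ltW.
by rewrite /cross; lra.
Qed.

(** Zorn's lemma is applied to the sets [B] with [A] united to [B] monotone, so that the empty chain
    is admissible too. *)
Lemma maximal_monotone_extension A : monotone_operator br A ->
  exists2 B, maximal_monotone br B & A `<=` B.
Proof.
move=> mA; have [|B [mB Bmax]] :=
    @Zorn_bigcup _ [set B | monotone_operator br (A `|` B)].
  move=> F Fm Ftot p p' [Ap|[B FB Bp]] [Ap'|[B' FB' Bp']].
  - exact: mA.
  - by apply: (Fm _ FB'); [left|right].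
  - by apply: (Fm _ FB); [right|left].
  have [BB|BB] := Ftot _ _ FB FB'.
    by apply: (Fm _ FB'); right => //; exact: BB.
  by apply: (Fm _ FB); right => //; exact: BB.
exists (A `|` B); last exact: subsetUl.
split=> // C mC ABC; apply/seteqP; split=> //.
apply: contrapT => CAB; apply: (Bmax C); last first.
  by rewrite /= setUidr// => x Ax; apply: ABC; left.
rewrite properEneq; split; last by move=> x Bx; apply: ABC; right.
by apply/eqP => BC; apply: CAB; rewrite -BC; exact: subsetUr.
Qed.

Lemma le0_of_small (d K : R) : (forall t, 0 < t < 1 -> d <= t * K) -> d <= 0.
Proof.
move=> dK; rewrite leNgt; apply/negP => d0.
have nK := normr_ge0 K; have K1 := ler_norm K.
have c0 : 0 < `|K| + d by lra.
(* Chosen so that [t * (|K| + d) = d / 2], which forces [t * K < d]. *)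
pose t := d / (2 * (`|K| + d)).
have tc : t * (2 * (`|K| + d)) = d by rewrite divfK// gt_eqF//; lra.
have t0 : 0 < t by rewrite divr_gt0//; lra.
have t1 : t < 1 by rewrite ltr_pdivrMr; lra.
have := dK t; rewrite t0 t1 => /(_ isT).
have : t * K <= t * `|K| by rewrite ler_pM2l.
have : 0 < t * d by exact: mulr_gt0.
by move: tc; rewrite mulrA mulrDr; lra.
Qed.

(* Fitzpatrick's minimality argument: at [t *: z + (1 - t) *: q] the bound [E]
   lies above the quadratic [br], and both agree at [t = 0]. *)
Lemma tangent_minorant (E : Q * S -> R -> Prop) q z r : convex_rel E ->
  (forall p s, E p s -> br p.1 p.2 <= s) -> E q (br q.1 q.2) -> E z r ->
  cross br q z - br q.1 q.2 <= r.
Proof.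
move=> cE Ege Eq Ez; rewrite -subr_le0.
apply: (@le0_of_small _ (cross br q z - br q.1 q.2 - br z.1 z.2)) => t t01.
have [t0 t1] := andP t01; rewrite -(ler_pM2l t0).
have /Ege := cE _ _ _ _ _ t01 Ez Eq; rewrite br_comb; set c := cross br q z.
have -> : cross br z q = c by rewrite /c /cross addrC.
set a := br z.1 z.2; set b := br q.1 q.2; move: a b c => a b c; lra.
Qed.

(* Near a point where the Fitzpatrick function is strictly below the pairing,
   every segment to its domain stays in the set of related points. *)
Lemma fitz_dom_monotone A q0 (r0 : R) :
  (forall p q, fitz A p (br p.1 p.2) -> fitz A q (br q.1 q.2) ->
     0 <= br (p.1 - q.1) (p.2 - q.2)) ->
  fitz A q0 r0 -> r0 < br q0.1 q0.2 ->
  forall p q (r s : R), fitz A p r -> fitz A q s ->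
    0 <= br (p.1 - q.1) (p.2 - q.2).
Proof.
move=> Gmono Aq0 r0q0.
have near_q0 p r : fitz A p r ->
    exists2 t0, 0 < t0 < 1 & forall t, 0 < t <= t0 ->
    let w := t *: p + (1 - t) *: q0 in fitz A w (br w.1 w.2).
  move=> Ap; set d := br q0.1 q0.2 - r0.
  have d0 : 0 < d by rewrite subr_gt0.
  (* At [t *: p + (1 - t) *: q0] the pairing minus the convex bound on the Fitzpatrick function is
     [d + t * B1 + t ^+ 2 * B2], nonnegative for small [t]. *)
  pose B1 : R := - 2 * br q0.1 q0.2 + cross br p q0 + r0 - r.
  pose B2 : R := br q0.1 q0.2 - cross br p q0 + br p.1 p.2.
  have c0 : 0 < `|B1| + `|B2| + d + 1.
    by have := normr_ge0 B1; have := normr_ge0 B2; lra.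
  exists (d / (2 * (`|B1| + `|B2| + d + 1))).
    have := normr_ge0 B1; have := normr_ge0 B2 => ? ?.
    by rewrite divr_gt0 ?mulr_gt0//= ltr_pdivrMr; lra.
  move=> t /andP[t0 tle] w a Aa.
  have t1 : t < 1.
    apply: le_lt_trans tle _; rewrite ltr_pdivrMr ?mulr_gt0//.
    by have := normr_ge0 B1; have := normr_ge0 B2; lra.
  have t01 : 0 < t < 1 by rewrite t0.
  have := fitz_convex t01 Ap Aq0 Aa; rewrite -/w => /le_trans; apply.
  rewrite /w br_comb.
  move: tle; rewrite ler_pdivlMr ?mulr_gt0// => tle.
  have h1 : - `|B1| <= B1 by rewrite lerNl -normrN ler_norm.
  have h2 : - `|B2| <= B2 by rewrite lerNl -normrN ler_norm.
  have h1' : t * - `|B1| <= t * B1 by rewrite ler_pM2l.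
  have tt : 0 < t * t by rewrite mulr_gt0.
  have h2' : t * t * - `|B2| <= t * t * B2 by rewrite ler_pM2l.
  have h3 : t * t * `|B2| <= t * `|B2|.
    by rewrite ler_wpM2r// ler_piMr// ltW.
  have td : 0 < t * d by exact: mulr_gt0.
  rewrite -subr_ge0.
  have -> : t ^+ 2 * br p.1 p.2 + t * (1 - t) * cross br p q0 +
      (1 - t) ^+ 2 * br q0.1 q0.2 - (t * r + (1 - t) * r0) =
      d + t * B1 + t * t * B2 by rewrite /d /B1 /B2; ring.
  clearbody B1 B2 d; move: tle; rewrite !mulrDr; lra.
move=> p q r s Ap Aq.
have [t1 /andP[t10 t11] Hp] := near_q0 _ _ Ap.
have [t2 /andP[t20 t21] Hq] := near_q0 _ _ Aq.
(* With a common weight the [q0] terms cancel, and the two points differ by [t *: (p - q)]. *)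
pose t := Num.min t1 t2.
have t0 : 0 < t by rewrite /t lt_min t10.
have {}Hp : _ := Hp t; have {}Hq : _ := Hq t.
move: Hp Hq; rewrite /= t0 /t !ge_min !lexx orbT -/t /=.
move=> /(_ isT) Hp /(_ isT) Hq.
have subE (V : lmodType R) (a b c : V) :
    t *: a + (1 - t) *: c - (t *: b + (1 - t) *: c) = t *: (a - b).
  by rewrite opprD addrACA subrr addr0 scalerBr.
have := Gmono _ _ Hp Hq; rewrite /= !subE.
by rewrite brZl brZr mulrA pmulr_rge0// mulr_gt0.
Qed.

(** The translate [L] through 0 is convex, so it is stable under factors below 1; maximality extends
    this to all positive factors, hence to sums. Finally [- u - v] and [u + v] have the same
    product, so [- u] is related to [L]. *)
Lemma convex_maximal_affine A : maximal_monotone br A ->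
  (forall p q t, 0 < t < 1 -> A p -> A q -> A (t *: p + (1 - t) *: q)) ->
  affine_subspace A.
Proof.
move=> Amax cA; have [a Aa] := maximal_nonempty Amax.
pose L := [set u | A (a + u)].
have L0 : L 0 by rewrite /L/= addr0.
have subDD (V : lmodType R) (b v w : V) : b + v - (b + w) = v - w.
  by rewrite opprD addrACA subrr add0r.
have subDB (V : lmodType R) (b v w : V) : v - (w - b) = b + v - w.
  by rewrite opprB addrA [v + b]addrC.
have LP u : L u <-> forall v, L v -> 0 <= br (u.1 - v.1) (u.2 - v.2).
  split=> [Lu v Lv|Lu].
    by have := Amax.1 _ _ Lu Lv; rewrite /= !subDD.
  apply: (maximal_related Amax) => p Ap.
  have /Lu : L (p - a) by rewrite /L/= addrC subrK.
  by rewrite /= !subDB.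
have Lconv u v t : 0 < t < 1 -> L u -> L v -> L (t *: u + (1 - t) *: v).
  move=> t01 Lu Lv; rewrite /L/=.
  suff -> : a + (t *: u + (1 - t) *: v) = t *: (a + u) + (1 - t) *: (a + v).
    exact: cA.
  by rewrite !scalerDr addrACA -scalerDl addrC [t + _]addrC subrK scale1r addrC.
have Lscale_lt1 u t : 0 < t < 1 -> L u -> L (t *: u).
  by move=> t01 Lu; have := Lconv _ _ _ t01 Lu L0; rewrite scaler0 addr0.
have Lscale u t : 0 < t -> L u -> L (t *: u).
  move=> t0 Lu; have [t1|t1|->] := ltgtP t 1; last by rewrite scale1r.
    by apply: Lscale_lt1; rewrite // t0.
  apply/LP => v Lv.
  (* The product at [t *: u - v] is [t ^+ 2] times the product at [u - t^-1 *: v]. *)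
  have /(LP u).1 : L (t^-1 *: v).
    by apply: Lscale_lt1; rewrite // invr_gt0 t0 invf_lt1.
  move=> /(_ Lu); rewrite -(pmulr_rge0 _ (mulr_gt0 t0 t0)) -mulrA -brZr -brZl.
  by rewrite /= !scalerBr !scalerA divff ?gt_eqF// !scale1r.
have LD u v : L u -> L v -> L (u + v).
  move=> Lu Lv; have h : 0 < (2^-1 : R) < 1 by rewrite invr_gt0 invf_lt1; lra.
  have := Lscale _ 2 ltac:(lra) (Lconv _ _ _ h Lu Lv).
  rewrite (_ : 1 - 2^-1 = 2^-1 :> R); last by lra.
  by rewrite -scalerDr scalerA divff ?scale1r.
have LN u : L u -> L (- u).
  move=> Lu; apply/LP => v Lv.
  have := (LP _).1 (LD _ _ Lu Lv) _ L0.
  by rewrite /= !subr0 !brE; lra.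
exists a, L; split=> // [c u v Lu Lv|].
  apply: LD => //; have [c0|c0|->] := ltgtP c 0; last by rewrite scale0r.
    by rewrite -[c]opprK scaleNr; apply/LN/Lscale; rewrite ?oppr_gt0.
  exact: Lscale.
apply/seteqP; split=> [p Ap|_ [u Lu <-]] //.
by exists (p - a); rewrite /L/= addrC subrK.
Qed.

End bilinear.
End pairings.

(** * Failure of the bidual inequality *)

Section embedding.
Context {R : realType} {X : normedModType R}.
Implicit Types (T : set (X * dual X)) (z : X * dual X)
  (q : dual (dual X) * dual X).

Lemma pairing_bilinear : bilinear_pairing (@pairing R X).
Proof. by split=> [c x y s|c x s t]; rewrite /pairing// linearP. Qed.

Lemma bipairing_bilinear : bilinear_pairing (@bipairing R X).
Proof. by split=> [c x y s|c x s t]; rewrite /bipairing// linearP. Qed.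

Local Notation lift T := [set (bidual_embed p.1, p.2) | p in T].

Lemma bidual_embedB (x y : X) :
  bidual_embed (x - y) = bidual_embed x - bidual_embed y.
Proof. by apply: dual_ext => f; exact: linearB. Qed.

Lemma cross_lift z q : cross bipairing (bidual_embed z.1, z.2) q = bracket q z.
Proof. exact: addrC. Qed.

Lemma fitz_lift T q r : fitz bipairing (lift T) q r <->
  forall a, T a -> bracket q a - pairing a.1 a.2 <= r.
Proof.
split=> [Tq a Ta|Tq _ [a Ta <-]]; last by rewrite cross_lift; exact: Tq.
have /Tq : lift T (bidual_embed a.1, a.2) by exists a.
by rewrite cross_lift.
Qed.

Lemma fitz_embed T z r : fitz bipairing (lift T) (bidual_embed z.1, z.2) r <->
  fitz pairing T z r.
Proof.
split=> [Tz a Ta|Tz _ [a Ta <-]]; last exact: Tz.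
by apply: (Tz (bidual_embed a.1, a.2)); exists a.
Qed.

Lemma gossez_closureE T q :
  gossez_closure T q <-> fitz bipairing (lift T) q (bipairing q.1 q.2).
Proof.
split=> [Tq|/(fitz_related bipairing_bilinear) Tq a Ta].
  by apply/(fitz_related bipairing_bilinear) => _ [a Ta <-]; exact: Tq.
by apply: (Tq (_, _)); exists a.
Qed.

Lemma lift_monotone T :
  monotone_operator pairing T -> monotone_operator bipairing (lift T).
Proof.
move=> mT _ _ [p Tp <-] [q Tq <-]; have := mT p q Tp Tq.
by rewrite -[pairing _ _]/(bipairing (bidual_embed _) _) bidual_embedB.
Qed.

(** Each point of the closure can be added to the lifted [T]; a maximal extension of the result must
    be [S], so the closure lies in [S]. *)
Lemma unique_extension_gossez_monotone T : monotone_operator pairing T ->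
  (exists! S, bidual_extension T S) ->
  monotone_operator bipairing (gossez_closure T).
Proof.
move=> mT [S [[Smax TS] Suniq]].
suff GS : gossez_closure T `<=` S by move=> p q /GS Sp /GS; exact: Smax.1.
move=> q /gossez_closureE/(fitz_related bipairing_bilinear) Gq.
have mTq : monotone_operator bipairing (lift T `|` [set q]).
  move=> p p' [Tp|->] [Tp'|->].
  - exact: (lift_monotone mT).
  - have := Gq p Tp; rewrite !(br_sub bipairing_bilinear) /cross; lra.
  - exact: Gq.
  - by rewrite !subrr (br0l bipairing_bilinear).
have [B Bmax AB] := maximal_monotone_extension mTq.
rewrite (Suniq B); first by apply: AB; right.
by split=> // p Tp; apply: AB; left.
Qed.

Lemma fitzpatrick_le T z r : (fitzpatrick T z <= r%:E)%E <-> fitz pairing T z r.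
Proof.
split=> [Tz a Ta|Tz].
  rewrite -lee_fin; apply: le_trans Tz.
  by apply: ereal_sup_ubound; exists a.
by apply: ge_ereal_sup => _ [a Ta <-]; rewrite lee_fin; exact: Tz.
Qed.

Lemma fitzpatrick_gtNy T z : T !=set0 -> (-oo < fitzpatrick T z)%E.
Proof.
move=> [a Ta]; apply: lt_le_trans (ltNyr _) _.
by apply: ereal_sup_ubound; exists a.
Qed.

Lemma lty_fitz T z : T !=set0 -> (fitzpatrick T z < +oo)%E ->
  exists2 r, fitz pairing T z r & fitzpatrick T z = r%:E.
Proof.
move=> /(fitzpatrick_gtNy z) Ny y; exists (fine (fitzpatrick T z)).
  by apply/fitzpatrick_le; rewrite fineK// fin_numE gt_eqF// lt_eqF.
by rewrite fineK// fin_numE gt_eqF// lt_eqF.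
Qed.

Lemma fitzpatrick_on T z : monotone_operator pairing T -> T z ->
  fitzpatrick T z = (pairing z.1 z.2)%:E.
Proof.
move=> mT Tz; apply/eqP; rewrite eq_le; apply/andP; split.
  by apply/fitzpatrick_le; exact: (fitz_monotone pairing_bilinear).
by apply: ereal_sup_ubound; exists z => //; rewrite addrK.
Qed.

Lemma fitzpatrick_ge T z : maximal_monotone pairing T ->
  ((pairing z.1 z.2)%:E <= fitzpatrick T z)%E.
Proof.
move=> Tmax; have T0 := maximal_nonempty pairing_bilinear Tmax.
rewrite leNgt; apply/negP => lt.
have [r /(fitz_ge pairing_bilinear Tmax) + E] :=
  lty_fitz T0 (lt_trans lt (ltry _)).
by move: lt; rewrite E lte_fin => /lt_le_trans h /h; rewrite ltxx.
Qed.

Lemma fitzpatrick_convex T : T !=set0 -> convex_efun (fitzpatrick T).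
Proof.
move=> T0 u v t t01 /(lty_fitz T0)[r Tu ->] /(lty_fitz T0)[s Tv ->].
rewrite -!EFinM -EFinD; apply/fitzpatrick_le.
exact: (fitz_convex pairing_bilinear).
Qed.

Lemma fitzpatrick_lsc T : lower_semicontinuous (fitzpatrick T).
Proof.
move=> z a /ereal_sup_gt[_ [b Tb <-]]; rewrite lte_fin => ab.
pose g (y : X * dual X) : R :=
  pairing b.1 y.2 + pairing y.1 b.2 - pairing b.1 b.2.
have cg : {for z, continuous g}.
  apply: cvgB; last exact: cvg_cst.
  apply: cvgD.
    apply: (@continuous_comp _ _ _ snd (bidual_embed b.1)).
      exact: cvg_snd.
    exact: dual_continuous.
  apply: (@continuous_comp _ _ _ fst b.2); first exact: cvg_fst.
  exact: dual_continuous.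
exists [set y | a < g y].
  by apply: (cg [set y | a < y]); exact: lt_nbhsr.
move=> y /= ay; rewrite -lte_fin in ay; apply: lt_le_trans ay _.
by apply: ereal_sup_ubound; exists b.
Qed.

(** Apply the tangent bound to [h] at each point of [T], where [h] touches the pairing. *)
Lemma fitzpatrick_minimal T h : fitzpatrick_family T h ->
  forall z r, (h z <= r%:E)%E -> fitz pairing T z r.
Proof.
move=> [hc _ hge hT] z r hzr a Ta.
apply: (@tangent_minorant _ _ _ _ pairing_bilinear
  (fun y s => (h y <= s%:E)%E)).
- move=> u v s t k k01 us vt.
  have := hc u v k k01 (le_lt_trans us (ltry _)) (le_lt_trans vt (ltry _)).
  move=> /le_trans; apply; have [k0 k1] := andP k01.
  rewrite [X in (_ <= X)%E]EFinD !EFinM leeD// lee_wpmul2l// lee_fin; lra.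
- by move=> p s hp; rewrite -lee_fin; exact: le_trans (hge p) hp.
- by rewrite hT.
- by [].
Qed.

(* Condition (NI): the extended Fitzpatrick function lies above the
   duality product of the bidual. *)
Definition representable_bidual T :=
  forall q r, fitz bipairing (lift T) q r -> bipairing q.1 q.2 <= r.

Lemma unique_extension_affine T : maximal_monotone pairing T ->
  (exists! S, bidual_extension T S) -> ~ representable_bidual T ->
  affine_nonenlargeable T.
Proof.
move=> Tmax Tuniq; rewrite /representable_bidual.
move=> /existsNP[q0 /existsNP[r0 /not_implyP[Tq0 /negP]]].
rewrite -ltNge => r0q0.
have Gmono := unique_extension_gossez_monotone Tmax.1 Tuniq.
have T0 := maximal_nonempty pairing_bilinear Tmax.
have dom_mono := @fitz_dom_monotone _ _ _ _ bipairing_bilinear (lift T) q0 r0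
  (fun p q Hp Hq =>
     Gmono p q ((gossez_closureE T p).2 Hp) ((gossez_closureE T q).2 Hq))
  Tq0 r0q0.
(* Points of [T] lie in the domain too, so monotonicity of the domain makes [z] related to [T]. *)
have domT z r : fitz pairing T z r -> T z.
  move=> /fitz_embed Tz; apply: (maximal_related pairing_bilinear Tmax) => a Ta.
  have la : lift T (bidual_embed a.1, a.2) by exists a.
  rewrite -[pairing _ _]/(bipairing (bidual_embed _) _) bidual_embedB.
  exact: dom_mono _ _ _ _ Tz (fitz_monotone bipairing_bilinear
    (lift_monotone Tmax.1) la).
have fitzE z : ~ T z -> fitzpatrick T z = +oo%E.
  move=> nTz; apply/eqP; rewrite -leye_eq leNgt; apply/negP.
  by move=> /(lty_fitz T0)[r /domT].
split.
- apply: (convex_maximal_affine pairing_bilinear Tmax) => p q t t01 Tp Tq.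
  apply: domT; apply: (fitz_convex pairing_bilinear t01).
    exact: (fitz_monotone pairing_bilinear Tmax.1 Tp).
  exact: (fitz_monotone pairing_bilinear Tmax.1 Tq).
- apply/funext => z; case: ifPn => [/set_mem Tz|].
    exact: fitzpatrick_on Tmax.1 Tz.
  by move=> /negP nTz; apply: fitzE => Tz; apply: nTz; exact: mem_set.
- apply/seteqP; split=> [h Fh|_ ->].
    apply/funext => z; have [Tz|nTz] := pselect (T z).
      by case: (Fh) => _ _ _ ->//; rewrite fitzpatrick_on//; exact: Tmax.1.
    rewrite fitzE//; apply/eqP; rewrite -leye_eq leNgt; apply/negP => hy.
    have hz : h z = (fine (h z))%:E.
      rewrite fineK// fin_numE [_ == +oo%E]lt_eqF// andbT gt_eqF//.
      by apply: lt_le_trans (ltNyr _) _; case: (Fh) => _ _ + _; exact.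
    apply/nTz/(domT z (fine (h z)))/(fitzpatrick_minimal Fh).
    by rewrite -hz.
  split; first exact: fitzpatrick_convex.
  - exact: fitzpatrick_lsc.
  - by move=> z; exact: fitzpatrick_ge.
  - by move=> z; exact: fitzpatrick_on Tmax.1.
Qed.

End embedding.

(** * The Brondsted-Rockafellar property *)

Section geometric.
Context {R : realType}.

Lemma le0_geometric (d K : R) : (forall n, d <= K / 2 ^+ n) -> d <= 0.
Proof.
move=> dK; rewrite leNgt; apply/negP => d0.
have [n Kn] : exists n : nat, K / d < n%:R.
  exists (Num.bound `|K / d|).
  exact: le_lt_trans (ler_norm _) (archi_boundP (normr_ge0 _)).
have := dK n; apply/negP; rewrite -ltNge ltr_pdivrMr ?exprn_gt0// mulrC.
rewrite -ltr_pdivrMr//; apply: lt_trans Kn _.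
by rewrite -natrX ltr_nat ltn_expl.
Qed.

Lemma geometric_cauchy (V : normedModType R) (u : nat -> V) (C : R) :
  (forall n, `|u n.+1 - u n| <= C / 2 ^+ n) ->
  forall n k, `|u (n + k)%N - u n| <= 2 * C / 2 ^+ n.
Proof.
move=> uC n k; have C0 : 0 <= C.
  by have := uC 0; rewrite expr0 divr1; exact: le_trans.
(* Strengthened for the induction: the subtracted tail absorbs the next increment. *)
suff : `|u (n + k)%N - u n| <= 2 * C / 2 ^+ n - 2 * C / 2 ^+ (n + k).
  move=> /le_trans; apply; rewrite gerBl divr_ge0 ?exprn_ge0//.
  by rewrite mulr_ge0.
elim: k => [|k IH]; first by rewrite addn0 !subrr normr0.
rewrite addnS -(subrK (u (n + k)%N) (u _.+1)) -addrA.
apply: le_trans (ler_normD _ _) _.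
have := uC (n + k)%N; move: IH; rewrite exprS invfM.
set a := _ / 2 ^+ n; have -> : 2 * C * (2^-1 * (2 ^+ (n + k))^-1) =
  C / 2 ^+ (n + k) by field; rewrite expf_neq0.
rewrite -mulrA; move: (C / _) => b; lra.
Qed.

Lemma geometric_limit (V : completeNormedModType R) (u : nat -> V) (C : R) :
  (forall n, `|u n.+1 - u n| <= C / 2 ^+ n) ->
  exists l, forall n, `|l - u n| <= 2 * C / 2 ^+ n.
Proof.
move=> uC; have uC' := geometric_cauchy uC.
have small (e : R) : 0 < e -> exists n, 2 * C / 2 ^+ n < e.
  move=> e0; apply: contrapT => /forallNP ne.
  suff : e <= 0 by rewrite leNgt e0.
  apply: (@le0_geometric _ (2 * C)) => n; rewrite leNgt.
  exact/negP/ne.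
have /cauchy_cvgP cu : cauchy (u @ \oo).
  apply: cauchy_exP => e e0; have [n ne] := small e e0.
  exists (u n); exists n => // m /= nm; rewrite -ball_normE/= distrC.
  by apply: le_lt_trans ne; rewrite -(subnKC nm).
exists (lim (u @ \oo)) => n.
apply/ler_addgt0Pr => e e0.
have /cvgrPdist_lt /(_ e e0) [N _ NP] := cu.
have /ltW lte := NP (n + N)%N (leq_addl _ _).
rewrite -(subrK (u (n + N)%N) (lim _)) -addrA.
apply: le_trans (ler_normD _ _) _; rewrite [leRHS]addrC.
by apply: lerD; [exact: lte|exact: uC'].
Qed.

(** The limit is taken pointwise in the reals; the error bound, proportional to [|x|], makes it
    linear, bounded and a limit in norm. *)
Lemma dual_geometric_limit (V : normedModType R) (f : nat -> dual V) (C : R) :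
  (forall n, `|f n.+1 - f n| <= C / 2 ^+ n) ->
  exists l, forall n, `|l - f n| <= 2 * C / 2 ^+ n.
Proof.
move=> fC.
have C0 : 0 <= C by have := fC 0; rewrite expr0 divr1; exact: le_trans.
have fx x n : `|f n.+1 x - f n x : R^o| <= C * `|x| / 2 ^+ n.
  have := dual_normP (f n.+1 - f n) x; move=> /le_trans; apply.
  by rewrite mulrAC ler_wpM2r//; exact: fC.
have /choice[l lP] : forall x, exists l : R^o, forall n,
    `|l - f n x| <= 2 * (C * `|x|) / 2 ^+ n.
  by move=> x; apply: (@geometric_limit R^o); exact: fx.
have ll : linear (l : V -> R^o).
  move=> c x y; apply/eqP; rewrite -subr_eq0 -normr_le0.
  apply: (@le0_geometric _ (2 * (C * `|c *: x + y|) + `|c| * (2 * (C * `|x|)) +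
    2 * (C * `|y|))) => n.
  have -> : l (c *: x + y) - (c *: l x + l y) =
     (l (c *: x + y) - f n (c *: x + y)) - c *: (l x - f n x) - (l y - f n y).
    have E (a b d a' b' : R) :
        a - (b + d) = a - (a' + b') - (b - a') - (d - b').
      by ring.
    by rewrite [f n (_ + _)]linearP scalerBr; exact: E.
  rewrite [leRHS]mulrDl [X in _ <= X + _]mulrDl; 
  apply: le_trans (ler_normB _ _) _; apply: lerD; last exact: lP.
  apply: le_trans (ler_normB _ _) _; apply: lerD; first exact: lP.
  by rewrite normrZ -mulrA ler_wpM2l.
pose lL : {linear V -> R^o} :=
  HB.pack (l : V -> R^o) (GRing.isLinear.Build _ _ _ _ _ ll).
have [|g gl] := @dual_of_bounded _ _ lL (`|f 0| + 2 * C).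
  move=> x x1; rewrite -[lL x]/(l x).
  have -> : l x = f 0%N x + (l x - f 0%N x) by rewrite addrC subrK.
  apply: lerD.
    apply: le_trans (ler_norm _) _; apply: le_trans (dual_normP _ _) _.
    exact: (ler_piMr (dual_norm_ge0 (f 0%N)) x1).
  apply: le_trans (ler_norm _) _; apply: le_trans (lP x 0) _.
  by rewrite expr0 divr1 ler_pM2l// ler_piMr.
exists g => n; apply: dual_norm_le.
  by rewrite divr_ge0 ?mulr_ge0.
move=> x; rewrite -[(g - f n) x]/(g x - f n x) gl; apply: le_trans (lP x n) _.
by rewrite mulrA mulrAC.
Qed.

End geometric.

(** * Regularization and iteration towards a point of the operator *)

Section brondsted_rockafellar.
Context {R : realType}.

Lemma pairing_norm (X : normedModType R) (x : X) (f : dual X) :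
  `|pairing x f| <= `|x| * `|f|.
Proof. by rewrite mulrC; exact: dual_normP. Qed.

Context {X : completeNormedModType R}.
Implicit Types (T : set (X * dual X)) (z w : X * dual X).

(* The functional minimised is the Fitzpatrick function plus half the squared
   norms, recentred at [z]. A separating affine functional [u] would violate
   [representable_bidual] at [u], tested at [(z.1 - x, u.2)] with [x] almost
   norming [u.2 - z.2]. *)
Lemma fitz_regularized T z (eta : R) : maximal_monotone pairing T ->
  representable_bidual T -> 0 < eta ->
  exists w r, fitz pairing T w r /\
    r + 2^-1 * `|w.1 - z.1| ^+ 2 + 2^-1 * `|w.2 - z.2| ^+ 2 <
    cross pairing z w - pairing z.1 z.2 + eta.
Proof.
move=> Tmax Trep eta0; apply: contrapT => nwr.
have [a0 Ta0] := maximal_nonempty pairing_bilinear Tmax.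
pose g w := 2^-1 * `|w.1 - z.1| ^+ 2 + 2^-1 * `|w.2 - z.2| ^+ 2 -
  (cross pairing z w - pairing z.1 z.2 + eta).
have cg : convex_real g.
  have c1 : convex_real (fun w => `|w.1 - z.1| ^+ 2).
    apply: convex_real_sqr => //.
    apply: (@convex_real_norm _ _ _ (fun w => w.1 - z.1)) => x y t.
    exact: convex_comb_subr.
  have c2 : convex_real (fun w => `|w.2 - z.2| ^+ 2).
    apply: convex_real_sqr => //.
    apply: (@convex_real_norm _ _ _ (fun w => w.2 - z.2)) => x y t.
    exact: convex_comb_subr.
  move=> x y t t01; have := c1 x y t t01; have := c2 x y t t01.
  by rewrite /g (cross_comb pairing_bilinear) /=; lra.
have [] := @sandwich_bidual _ _ (fitz pairing T) g
  (2^-1 * (1 + `|z.1|) ^+ 2 + 2^-1 * (1 + `|z.2|) ^+ 2 +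
   `|z.1| + `|z.2| + pairing z.1 z.2)
  (fitz_convex pairing_bilinear (A := T)) cg.
- exists a0, (pairing a0.1 a0.2).
  exact: (fitz_monotone pairing_bilinear Tmax.1 Ta0).
- move=> w w1 w2; rewrite /g.
  have sq (V : normedModType R) (a b : V) : `|a| <= 1 ->
      `|a - b| ^+ 2 <= (1 + `|b|) ^+ 2.
    move=> a1; rewrite ler_sqr ?nnegrE ?addr_ge0//.
    by rewrite (le_trans (ler_normB _ _))// lerD2r.
  have h1 := sq _ w.1 z.1 w1; have h2 := sq _ w.2 z.2 w2.
  have h3 : `|pairing z.1 w.2| <= `|z.1|.
    by rewrite (le_trans (pairing_norm _ _))// ler_piMr.
  have h4 : `|pairing w.1 z.2| <= `|z.2|.
    by rewrite (le_trans (pairing_norm _ _))// ler_piMl.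
  move: h3 h4; rewrite !ler_norml /cross => /andP[h3 _] /andP[h4 _]; lra.
- move=> w r Tw; rewrite leNgt; apply/negP => lt; apply: nwr; exists w, r.
  by split=> //; move: lt; rewrite /g; lra.
move=> u uE.
have uT b : bipairing u.1 u.2 <= bracket u b + g b.
  apply: Trep; apply/fitz_lift => a Ta.
  have := uE a (pairing a.1 a.2) b (fitz_monotone pairing_bilinear Tmax.1 Ta).
  by lra.
have e2 : 0 < eta / 2 by lra.
have [x xle ux] := dual_approx_norm (u.2 - z.2) (normr_ge0 (u.2 - z.2)) e2.
have := uT (z.1 - x, u.2).
have -> : bracket u (z.1 - x, u.2) =
    bipairing u.1 u.2 + pairing z.1 u.2 - pairing x u.2.
  rewrite -[LHS]/(bipairing u.1 u.2 + pairing (z.1 - x) u.2).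
  by rewrite !(brE pairing_bilinear) addrA.
have -> : g (z.1 - x, u.2) = 2^-1 * `|x| ^+ 2 + 2^-1 * `|u.2 - z.2| ^+ 2 -
    (pairing z.1 u.2 - pairing x z.2 + eta).
  rewrite -[LHS]/(2^-1 * `|z.1 - x - z.1| ^+ 2 + 2^-1 * `|u.2 - z.2| ^+ 2 -
    (pairing z.1 u.2 + pairing (z.1 - x) z.2 - pairing z.1 z.2 + eta)).
  rewrite [z.1 - x - _]addrAC subrr add0r normrN.
  by rewrite !(brE pairing_bilinear); ring.
have xx : `|x| ^+ 2 <= `|u.2 - z.2| ^+ 2 by rewrite ler_sqr ?nnegrE.
have uzx : (u.2 - z.2) x = pairing x u.2 - pairing x z.2 :> R by [].
(* The terms in [u.1] cancel. What remains bounds 0 by half the sum of the squares minus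
   [(u.2 - z.2) x + eta], which is at most [- eta / 2] by the choice of [x]. *)
move: ux xx; rewrite uzx -expr2.
move: (`|x| ^+ 2) (`|u.2 - z.2| ^+ 2) => A B; lra.
Qed.

(** Regularize with [eta = (s / 2) ^+ 2]. The squared norms absorb the product of [w - z], leaving
    the defect [eta] at [w]; the distances are controlled by comparing with the midpoint. *)
Lemma fitz_halving T z (s : R) : maximal_monotone pairing T ->
  representable_bidual T -> 0 < s ->
  fitz pairing T z (pairing z.1 z.2 + s ^+ 2) ->
  exists w, [/\ fitz pairing T w (pairing w.1 w.2 + (s / 2) ^+ 2),
    `|w.1 - z.1| <= 3 * s & `|w.2 - z.2| <= 3 * s].
Proof.
move=> Tmax Trep s0 Tz.
have eta0 : 0 < (s / 2) ^+ 2 by rewrite exprn_gt0// divr_gt0.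
have [w [r [Tw rw]]] := fitz_regularized z Tmax Trep eta0.
have := br_sub pairing_bilinear w z.
have := pairing_norm (w.1 - z.1) (w.2 - z.2); rewrite ler_norml => /andP[+ _].
have n1 := normr_ge0 (w.1 - z.1); have n2 := normr_ge0 (w.2 - z.2).
have h : 0 < (2^-1 : R) < 1 by rewrite invr_gt0 invf_lt1; lra.
(* At the midpoint of [w] and [z] the Fitzpatrick function is still above the pairing. *)
have := fitz_ge pairing_bilinear Tmax (fitz_convex pairing_bilinear h Tw Tz).
rewrite (br_comb pairing_bilinear) [cross pairing w z]addrC.
rewrite -/(cross pairing z w).
move: rw n1 n2.
set d1 := `|w.1 - z.1|; set d2 := `|w.2 - z.2|; set c := cross pairing z w.
set b := pairing (w.1 - z.1) _; set pz := pairing z.1 _.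
set pw := pairing w.1 _.
move=> rw n1 n2 hm hb bE.
have dd := sqr_ge0 (d1 - d2).
have dd' : (d1 - d2) ^+ 2 = d1 ^+ 2 + d2 ^+ 2 - 2 * (d1 * d2) by ring.
have d1d2 : d1 ^+ 2 + d2 ^+ 2 <= 9 * s ^+ 2.
  clearbody d1 d2 c b pz pw; nra.
have s3 : 0 <= 3 * s by lra.
exists w; split.
- move=> a Ta; apply: le_trans (Tw a Ta) _; rewrite -/pw.
  clearbody d1 d2 c b pz pw; lra.
- rewrite -/d1 -ler_sqr ?nnegrE// exprMn; have := sqr_ge0 d2; lra.
- rewrite -/d2 -ler_sqr ?nnegrE// exprMn; have := sqr_ge0 d1; lra.
Qed.

Lemma brondsted_rockafellar T z (s : R) : maximal_monotone pairing T ->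
  representable_bidual T -> 0 < s ->
  fitz pairing T z (pairing z.1 z.2 + s ^+ 2) ->
  exists a, [/\ T a, `|a.1 - z.1| <= 6 * s & `|a.2 - z.2| <= 6 * s].
Proof.
move=> Tmax Trep s0 Tz.
(* A total step function on pairs of a radius and a point; its value 0 outside the hypotheses is
   arbitrary. *)
have /choice[nxt nxtP] : forall p : R * (X * dual X), exists w, 0 < p.1 ->
    fitz pairing T p.2 (pairing p.2.1 p.2.2 + p.1 ^+ 2) ->
    [/\ fitz pairing T w (pairing w.1 w.2 + (p.1 / 2) ^+ 2),
    `|w.1 - p.2.1| <= 3 * p.1 & `|w.2 - p.2.2| <= 3 * p.1].
  move=> [t y] /=; have [[t0 Ty]|nT] := pselect (0 < t /\
      fitz pairing T y (pairing y.1 y.2 + t ^+ 2)).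
    by have [w wP] := fitz_halving Tmax Trep t0 Ty; exists w.
  by exists 0 => t0 Ty; exfalso; exact: nT.
pose fix u n := if n is m.+1 then nxt (s / 2 ^+ m, u m) else z.
have sn n : 0 < s / 2 ^+ n by rewrite divr_gt0 ?exprn_gt0.
have uT n : fitz pairing T (u n) (pairing (u n).1 (u n).2 + (s / 2 ^+ n) ^+ 2).
  elim: n => [|n IH]; first by rewrite /= expr0 divr1.
  have [+ _ _] := nxtP (s / 2 ^+ n, u n) (sn n) IH.
  suff -> : s / 2 ^+ n / 2 = s / 2 ^+ n.+1 by [].
  by rewrite exprSr invfM mulrA.
have uS n := nxtP (s / 2 ^+ n, u n) (sn n) (uT n).
have [|x xP] := @geometric_limit _ _ (fun n => (u n).1) (3 * s).
  by move=> n; have [_ + _] := uS n; rewrite /= mulrA.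
have [|f fP] := @dual_geometric_limit _ _ (fun n => (u n).2) (3 * s).
  by move=> n; have [_ _] := uS n; rewrite /= mulrA.
have E6 : 2 * (3 * s) = 6 * s by ring.
exists (x, f); split=> /=; last 2 first.
- by have := xP 0%N; rewrite /= expr0 divr1 E6.
- by have := fP 0%N; rewrite /= expr0 divr1 E6.
apply: (maximal_related pairing_bilinear Tmax) => b Tb.
rewrite -[X in 0 <= X]/(pairing (x - b.1) (f - b.2)) -oppr_le0.
(* The defect at [u n] and the cost of replacing [u n] by its limit are both of order [1 / 2 ^+ n];
   this constant collects them. *)
apply: (@le0_geometric _ _
  (s ^+ 2 + 6 * s * (`|f - b.2| + `|x - b.1| + 6 * s))) => n.
have h1 : - (s / 2 ^+ n) ^+ 2 <= pairing ((u n).1 - b.1) ((u n).2 - b.2).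
  by have := uT n b Tb; rewrite (br_sub pairing_bilinear); lra.
have xn : `|x - (u n).1| <= 6 * s / 2 ^+ n by rewrite -E6; exact: xP.
have fn : `|f - (u n).2| <= 6 * s / 2 ^+ n by rewrite -E6; exact: fP.
have h2 := pairing_norm (x - (u n).1) (f - b.2).
have h3 := pairing_norm ((u n).1 - b.1) (f - (u n).2).
have h4 : pairing (x - b.1) (f - b.2) =
    pairing ((u n).1 - b.1) ((u n).2 - b.2) +
    pairing (x - (u n).1) (f - b.2) + pairing ((u n).1 - b.1) (f - (u n).2).
  by rewrite !(brE pairing_bilinear); ring.
have pn : 1 <= 2 ^+ n :> R by rewrite exprn_ege1// ler1n.
have pn0 : 0 < 2 ^+ n :> R by rewrite exprn_gt0.
pose k : R := (2 ^+ n)^-1.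
have k0 : 0 < k by rewrite invr_gt0.
have k1 : k <= 1 by rewrite invf_le1.
have h5 : `|(u n).1 - b.1| <= `|x - b.1| + 6 * s.
  rewrite -(subrK x ((u n).1)) -addrA addrC (le_trans (ler_normD _ _))// lerD2l.
  rewrite distrC (le_trans xn)// ler_piMr//; lra.
move: h1 xn fn; rewrite -/k => h1 xn fn.
have h2' : `|pairing (x - (u n).1) (f - b.2)| <= 6 * s * k * `|f - b.2|.
  by rewrite (le_trans h2)// ler_wpM2r.
have h3' : `|pairing ((u n).1 - b.1) (f - (u n).2)| <=
    (`|x - b.1| + 6 * s) * (6 * s * k).
  by rewrite (le_trans h3)// ler_pM.
have h6 : (s * k) ^+ 2 <= s ^+ 2 * k.
  by rewrite exprMn ler_wpM2l ?sqr_ge0// expr2 ler_piMl// ltW.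
rewrite h4; move: h2' h3' => /ler_normlP[h2' _] /ler_normlP[h3' _].
rewrite [leRHS](_ : _ = s ^+ 2 * k + 6 * s * k * `|f - b.2| +
  (`|x - b.1| + 6 * s) * (6 * s * k)); last by ring.
lra.
Qed.

End brondsted_rockafellar.

(** * Type (D) *)

Section type_D.
Context {R : realType}.

(** The relation [E] is the epigraph of the conjugate of the Fitzpatrick function. The conjugate is
    convex and, by testing on [T], above the extended Fitzpatrick function, hence above the pairing;
    it touches the pairing at [q], so the tangent bound applies. *)
Lemma fitz_conjugate_ge (X : normedModType R) (T : set (X * dual X))
    (q u : dual (dual X) * dual X) (r : R) :
  maximal_monotone pairing T -> representable_bidual T -> gossez_closure T q ->
  (forall z s, fitz pairing T z s -> bracket u z - s <= r) ->
  cross bipairing q u - bipairing q.1 q.2 <= r.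
Proof.
move=> Tmax Trep /gossez_closureE Tq uT.
pose E v c := forall z s, fitz pairing T z s -> bracket v z - s <= c.
have EP : convex_rel E.
  move=> v w c d t /andP[t0 t1] vc wd z s Tz.
  have {}vc := vc z s Tz; have {}wd := wd z s Tz.
  rewrite -cross_lift (cross_comb bipairing_bilinear) !cross_lift.
  have : t * (bracket v z - s) <= t * c by rewrite ler_pM2l.
  have : (1 - t) * (bracket w z - s) <= (1 - t) * d by rewrite ler_pM2l//; lra.
  lra.
apply: (tangent_minorant bipairing_bilinear EP) uT.
  move=> v c vE; apply: Trep; apply/fitz_lift => a Ta.
  exact/vE/(fitz_monotone pairing_bilinear Tmax.1).
(* Contact at [q]: the tangent bound for the extended Fitzpatrick function says that the conjugate
   is at most the pairing there. *)
move=> z s /fitz_embed Tz.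
have := tangent_minorant bipairing_bilinear
  (fitz_convex bipairing_bilinear (A := _)) Trep Tq Tz.
by rewrite -[cross _ _ _]/(bracket q z); lra.
Qed.

(** The penalty [h] measures the distance to [q]. Duality and Goldstine's theorem give a point where
    the Fitzpatrick function plus [h] is below the pairing at [q] plus [eta]; the tangent bound at
    [q] then forces [h] to be small. *)
Lemma gossez_approximation (X : normedModType R) (T : set (X * dual X))
    (q : dual (dual X) * dual X) (L : seq (dual X)) (eta : R) :
  maximal_monotone pairing T -> representable_bidual T -> gossez_closure T q ->
  0 < eta <= 1 ->
  exists z, [/\ fitz pairing T z (pairing z.1 z.2 + eta * (`|q.1| + 3)),
    `|z.1| <= `|q.1| + 1, `|z.2 - q.2| <= eta &
    \sum_(f <- L) `|f z.1 - q.1 f : R| <= eta].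
Proof.
move=> Tmax Trep Tq /andP[eta0 eta1].
pose M := `|q.1|; have M0 : 0 <= M by exact: normr_ge0.
(* Including [q.2] controls the product of [z.1] with [q.2]. *)
pose N x := \sum_(f <- q.2 :: L) `|f x - q.1 f : R|.
have N0 x : 0 <= N x by apply: sumr_ge0.
(* The tangent bound loses at most [M * D + B], with [D] the distance to [q.2] and [B] the error on
   [q.2]; the weight [M + 2] absorbs this loss. *)
pose h (w : X * dual X) :=
  (M + 2) * (N w.1 + `|w.2 - q.2|) + Num.max 0 (`|w.1| - M).
have ch : convex_real h.
  apply: convex_realD.
    apply: convex_realZ; first lra.
    apply: convex_realD.
      apply: convex_real_sum => f.
      apply: (@convex_real_norm _ _ R^o (fun w => f w.1 - q.1 f)) => x y t.
      by rewrite linearD !linearZ; exact: convex_comb_subr.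
    apply: (@convex_real_norm _ _ _ (fun w => w.2 - q.2)) => x y t.
    exact: convex_comb_subr.
  apply/convex_real_max0/convex_realB.
  exact: (@convex_real_norm _ _ _ (fun w => w.1)).
pose g w := h w - (bipairing q.1 q.2 + eta).
have cg : convex_real g.
  exact: convex_realB.
have [z [r [Tz zr]]] : exists z r, fitz pairing T z r /\ r + g z < 0.
  apply: contrapT => nzr.
  have [a0 Ta0] := maximal_nonempty pairing_bilinear Tmax.
  have [] := @sandwich_bidual _ _ (fitz pairing T) g
    ((M + 2) * (\sum_(f <- q.2 :: L) (`|f| + `|q.1 f : R|) + (1 + `|q.2|)) + 1 -
     (bipairing q.1 q.2 + eta)) (fitz_convex pairing_bilinear (A := T)) cg.
  - exists a0, (pairing a0.1 a0.2).
    exact: (fitz_monotone pairing_bilinear Tmax.1 Ta0).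
  - move=> w w1 w2; rewrite /g lerD2r /h; apply: lerD.
      rewrite ler_wpM2l//; first lra.
      apply: lerD; last by rewrite (le_trans (ler_normB _ _))// lerD2r.
      apply: ler_sum => f _; rewrite (le_trans (ler_normB _ _))// lerD2r.
      rewrite (le_trans (dual_normP _ _))//.
      exact: (ler_piMr (dual_norm_ge0 _)).
    by rewrite ge_max ler01/= lerBlDr (le_trans w1)// lerDl.
  - by move=> w r Tw; rewrite leNgt; apply/negP => lt; apply: nzr; exists w, r.
  move=> u uE.
  have e0 : 0 < eta / (M + 2) by rewrite divr_gt0//; lra.
  (* At [(x, q.2)] the second-component and norm penalties vanish; the list also contains [u.2], to
     compare [u.2 x] with [q.1 u.2]. *)
  have [x xM] := goldstine q.1 (u.2 :: q.2 :: L) e0.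
  have : cross bipairing q u - bipairing q.1 q.2 <=
      bracket u (x, q.2) + g (x, q.2).
    apply: (fitz_conjugate_ge Tmax Trep Tq) => z s Tz.
    by have := uE z s (x, q.2) Tz; lra.
  have -> : bracket u (x, q.2) = bipairing u.1 q.2 + u.2 x by [].
  have -> : g (x, q.2) = (M + 2) * N x - (bipairing q.1 q.2 + eta).
    rewrite /g /h /= subrr normr0 addr0; congr (_ - _).
    by rewrite max_l ?addr0// subr_le0.
  have -> : cross bipairing q u = q.1 u.2 + bipairing u.1 q.2 by [].
  have Nx := N0 x; have := ler_norm (u.2 x - q.1 u.2 : R).
  have := normr_ge0 (u.2 x - q.1 u.2 : R).
  rewrite big_cons -/(N x) ltr_pdivlMr; last lra.
  set b := `| _ : R|; set c : R := q.1 u.2; set d : R := u.2 x => b0 cb.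
  have : 0 <= M * b by exact: mulr_ge0.
  lra.
have Tzq : bracket q z - bipairing q.1 q.2 <= r.
  have /fitz_embed Tz' := Tz.
  exact: (tangent_minorant bipairing_bilinear
    (fitz_convex bipairing_bilinear (A := _)) Trep
    ((gossez_closureE _ _).1 Tq) Tz').
have NE : N z.1 = `|q.2 z.1 - q.1 q.2 : R| + \sum_(f <- L) `|f z.1 - q.1 f : R|.
  by rewrite /N big_cons.
have S0 : 0 <= \sum_(f <- L) `|f z.1 - q.1 f : R| by exact: sumr_ge0.
have D0 := normr_ge0 (z.2 - q.2).
have m0 : 0 <= Num.max 0 (`|z.1| - M) by rewrite le_max lexx.
have mz : `|z.1| - M <= Num.max 0 (`|z.1| - M) by rewrite le_max lexx orbT.
have h1 := ler_norm (q.1 q.2 - q.2 z.1 : R); rewrite distrC in h1.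
have h2 : bipairing q.1 (q.2 - z.2) <= M * `|z.2 - q.2|.
  rewrite -[in leRHS]opprB normrN; apply: le_trans (ler_norm _) _.
  exact: dual_normP.
have h3 : pairing z.1 (q.2 - z.2) <= `|z.1| * `|z.2 - q.2|.
  rewrite -[in leRHS]opprB normrN; apply: le_trans (ler_norm _) _.
  exact: pairing_norm.
move: h2 h3; rewrite (brE pairing_bilinear) !(brE bipairing_bilinear).
rewrite (brE pairing_bilinear) => h2 h3.
move: zr Tzq h1; rewrite /g /h NE /bracket.
rewrite -[q.2 z.1]/(pairing z.1 q.2) -[q.1 q.2]/(bipairing q.1 q.2).
have := normr_ge0 (pairing z.1 q.2 - bipairing q.1 q.2).
move: S0 D0 m0 mz h2 h3.
set S := \sum_(f <- L) _; set D := `|z.2 - q.2|; set m := Num.max _ _.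
set B := `|_ - _|.
set x1 := pairing _ _; set x2 := bipairing _ _; set x3 := bipairing _ _.
set x4 := pairing _ _ => S0 D0 m0 mz h2 h3 B0 zr Tzq h1.
have MB : 0 <= M * B by exact: mulr_ge0.
have MS : 0 <= M * S by exact: mulr_ge0.
have tot : B + S + D + m < eta by lra.
have zM : `|z.1| <= M + 1 by lra.
have De : D <= eta by lra.
have Se : S <= eta by lra.
exists z; split; [|exact: zM|exact: De|exact: Se].
have zD : `|z.1| * D <= (M + 1) * eta by apply: ler_pM => //; lra.
move=> a Ta; apply: le_trans (Tz a Ta) _.
have MD : 0 <= M * D by exact: mulr_ge0.
have h0 : 0 <= (M + 2) * (B + S + D) by rewrite mulr_ge0//; lra.
rewrite -/M; move: zr; rewrite -/x1; lra.
Qed.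

End type_D.

(** * Nets and weak-star convergence *)

Section nets.
Context {R : realType}.

Lemma tails_filter (I : Type) (le : I -> I -> Prop) :
  directed le -> Filter (tails le).
Proof.
move=> [[i0] _ letr leub]; apply: filter_from_filter; first by exists i0.
move=> i j _ _; have [k ik jk] := leub i j; exists k => // l kl.
by split; exact: letr kl.
Qed.

Lemma cvg_weak_star_bidual (X : normedModType R)
    (F : set_system (dual (dual X))) (u : dual (dual X)) : Filter F ->
  (forall f : dual X, (v f : R^o) @[v --> F] --> (u f : R^o)) ->
  F --> (u : weak_star_bidual X).
Proof.
move=> FF Fu.
set ev := fun v : dual (dual X) => (dual_fun v : {ptws dual X -> R^o}).
have evF : ev @ F --> ev u.
  exact/(@pointwise_cvgP _ _ (ev @ F) (ev u)).
move=> A; rewrite nbhsE => -[B [[C oC <-] Cu] CA].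
by apply: (filterS CA); apply: evF; exact: open_nbhs_nbhs.
Qed.

Lemma representable_type_D (X : completeNormedModType R)
    (T : set (X * dual X)) :
  maximal_monotone pairing T -> representable_bidual T -> gossez_type_D T.
Proof.
move=> Tmax Trep q Tq.
have /choice[a aP] : forall i : seq (dual X) * nat, exists a : X * dual X,
    [/\ T a, `|a.1| <= `|q.1| + 2, `|a.2 - q.2| <= i.2.+1%:R^-1 &
      forall f, f \in i.1 -> `|f a.1 - q.1 f : R| <= i.2.+1%:R^-1].
  move=> [L n] /=; set d : R := n.+1%:R^-1.
  have d0 : 0 < d by rewrite invr_gt0.
  have d1 : d <= 1 by rewrite invf_le1// ler1n.
  have := normr_ge0 q.1; set M := `|q.1| => M0.
  pose B := 1 + \sum_(f <- L) `|f|.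
  have BL f : f \in L -> `|f| <= B.
    move=> fL; rewrite /B (big_rem f)//= addrCA lerDl addr_ge0//.
    exact: sumr_ge0.
  have B1 : 1 <= B by rewrite lerDl; exact: sumr_ge0.
  (* A move of length [6 * s] changes each [f] in [L] by at most [6 * s * B = d / 2]. Below, [eta]
     is chosen so that the defect [eta * (M + 3)] is exactly [s ^+ 2]. *)
  have B0 : 0 < B by exact: lt_le_trans B1.
  pose s := d / (12 * B).
  have s0 : 0 < s by rewrite divr_gt0// mulr_gt0.
  have sB : s * B = d / 12 by rewrite /s; field; rewrite gt_eqF.
  have sd : s <= d / 12 by rewrite -sB ler_peMr// ltW.
  clearbody s.
  have M3 : 0 < M + 3 by exact: ltr_wpDl.
  pose eta := s ^+ 2 / (M + 3).
  have eta0 : 0 < eta by rewrite divr_gt0// exprn_gt0.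
  have etaM : eta * (M + 3) = s ^+ 2 by rewrite divfK// gt_eqF.
  have etas : eta <= s.
    rewrite ler_pdivrMr// expr2 ler_pM2l//; lra.
  have [|z [Tz zM zq zL]] := gossez_approximation L Tmax Trep Tq (eta := eta).
    by rewrite eta0/=; lra.
  rewrite -/M in zM.
  move: Tz; rewrite etaM.
  move=> /(brondsted_rockafellar Tmax Trep s0)[w [Tw wz1 wz2]].
  exists w; split=> //.
  - rewrite -(subrK z.1 w.1); apply: le_trans (ler_normD _ _) _; lra.
  - rewrite -(subrK z.2 w.2) -addrA; apply: le_trans (ler_normD _ _) _; lra.
  - move=> f fL.
    have h1 : `|f z.1 - q.1 f : R| <= eta.
      apply: le_trans zL; rewrite (big_rem f)//= lerDl; exact: sumr_ge0.
    have h2 : `|f w.1 - f z.1 : R| <= B * (6 * s).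
      rewrite -[f w.1 - f z.1]/(f w.1 - f z.1 : R^o) -linearB.
      apply: le_trans (dual_normP _ _) _; apply: ler_pM => //.
        exact: dual_norm_ge0.
      exact: BL.
    have E : `|f w.1 - q.1 f : R| <=
        `|f w.1 - f z.1 : R| + `|f z.1 - q.1 f : R|.
      exact: ler_distD.
    move: sB h1 h2 E; rewrite mulrCA [B * s]mulrC; lra.
(* The net is indexed by finite lists of functionals and precisions, so each functional is
   eventually tested at each precision. *)
pose le (i j : seq (dual X) * nat) := {subset i.1 <= j.1} /\ (i.2 <= j.2)%N.
have dle : directed le.
  split=> [|i|i j k [ij1 ij2] [jk1 jk2]|i j].
  - by constructor; exact: ([::], 0%N).
  - by split.
  - by split; [move=> f /ij1/jk1|exact: leq_trans jk2].
  - exists (i.1 ++ j.1, maxn i.2 j.2);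
      split=> /=; rewrite ?leq_maxl ?leq_maxr//.
      by move=> f fi; rewrite mem_cat fi.
    by move=> f fj; rewrite mem_cat fj orbT.
have FF := tails_filter dle.
have invle (m n : nat) : (m <= n)%N -> n.+1%:R^-1 <= m.+1%:R^-1 :> R.
  by move=> mn; rewrite lef_pV2 ?posrE ?ltr0n// ler_nat.
have small (e : R) : 0 < e -> exists n, n.+1%:R^-1 < e.
  move=> e0; have [n _ nP] := near_infty_natSinv_lt (PosNum e0).
  by exists n; exact: (nP n (leqnn n)).
exists (seq (dual X) * nat)%type, le, a; split=> //.
- by move=> i; have [] := aP i.
- exists (`|q.1| + `|q.2| + 2); split; first exact: num_real.
  move=> K MK _ [i _ <-]; have [_ a1 a2 _] := aP i.
  have := normr_ge0 q.1; have := normr_ge0 q.2 => q2 q1.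
  have a2' : `|(a i).2| <= `|q.2| + 1.
    rewrite -(subrK q.2 (a i).2); apply: le_trans (ler_normD _ _) _.
    rewrite [leLHS]addrC lerD2l; apply: le_trans a2 _.
    by have := invle 0%N i.2 (leq0n _); rewrite invr1.
  rewrite /= prod_normE ge_max; apply/andP; split.
    by apply: le_trans a1 _; lra.
  by apply: le_trans a2' _; lra.
- have cvg1 : (fun i => bidual_embed (a i).1 : weak_star_bidual X) @ tails le
      --> (q.1 : weak_star_bidual X).
    apply: cvg_weak_star_bidual => f.
    apply/cvgrPdist_le => e e0; have [n ne] := small e e0.
    exists ([:: f], n) => // i [/= fi ni]; have [_ _ _ /(_ f)] := aP i.
    rewrite fi ?mem_head// => /(_ isT); rewrite distrC => /le_trans; apply.
    by apply: le_trans (invle _ _ ni) _; exact: ltW.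
  have cvg2 : (fun i => (a i).2) @ tails le --> q.2.
    apply/cvgrPdist_le => e e0; have [n ne] := small e e0.
    exists ([::], n) => // i [/= _ ni]; have [_ _ + _] := aP i.
    rewrite distrC => /le_trans; apply.
    by apply: le_trans (invle _ _ ni) _; exact: ltW.
  rewrite [q]surjective_pairing.
  exact: (cvg_pair cvg1 cvg2).
Qed.

End nets.

Theorem theorem4p5 (R : realType) (X : completeNormedModType R)
    (T : set (X * dual X)) :
  maximal_monotone (@pairing R X) T ->
  (exists! S : set (dual (dual X) * dual X), bidual_extension T S) ->
  gossez_type_D T \/ affine_nonenlargeable T.
Proof.
move=> Tmax Tuniq; have [Trep|nTrep] := pselect (representable_bidual T).
  by left; exact: representable_type_D.
by right; exact: unique_extension_affine.
Qed.
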